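(* The collection of the quantum tori $\mathbf T_{\mathbf i}$, for all seeds $\mathbf i$ equivalent to a given seed, and the quantum mutation maps $\mu_k^q$ provide a functor $\widehat{\mathcal G}\to\mathrm{QPos}^*$ from the special cluster modular groupoid to the category $\mathrm{QPos}^*$.
   Context: A seed $\mathbf i=(I,I_0,\varepsilon,d)$ consists of a finite set $I$, a subset $I_0\subset I$ of frozen elements, a $\mathbb Q$-valued function $\varepsilon=(\varepsilon_{ij})$ on $I\times I$ with $\varepsilon_{ij}\in\mathbb Z$ unless $i,j$ are both in $I_0$, and positive integers $\{d_i\}_{i\in I}$ with greatest common divisor $1$ such that $\widehat\varepsilon_{ij}:=\varepsilon_{ij}d_j^{-1}$ is skew-symmetric. For $k\in I\setminus I_0$ the mutated seed $\mathbf i'=\mu_k(\mathbf i)=(I,I_0,\varepsilon',d)$ is given by $\varepsilon'_{ij}=-\varepsilon_{ij}$ if $k\in\{i,j\}$; $\varepsilon'_{ij}=\varepsilon_{ij}$ if $k\notin\{i,j\}$ and $\varepsilon_{ik}\varepsilon_{kj}\le 0$; $\varepsilon'_{ij}=\varepsilon_{ij}+|\varepsilon_{ik}|\varepsilon_{kj}$ if $k\notin\{i,j\}$ and $\varepsilon_{ik}\varepsilon_{kj}>0$. Seed isomorphisms are bijections of index sets preserving frozen elements, $\varepsilon$, $d$; seed cluster transformations are compositions of mutations and seed isomorphisms. Quantum tori. $\mathbf T_{\mathbf i}$ is the algebra over the ring of Laurent polynomials in a formal variable $q$ (with the necessary fractional powers of $q$ adjoined) generated by $X_i^{\pm1}$,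 $i\in I$, with relations $q^{-\widehat\varepsilon_{ij}}X_iX_j=q^{-\widehat\varepsilon_{ji}}X_jX_i$, and with the involutive antiautomorphism $\ast X_i=X_i$, $\ast q=q^{-1}$. $\mathbb T_{\mathbf i}$ is its non-commutative fraction field. Put $q_k=q^{1/d_k}$. Quantum mutation. $\mu_k^q:\mathbb T_{\mathbf i'}\to\mathbb T_{\mathbf i}$ is conjugation by the quantum dilogarithm $\mathbf\Psi_{q_k}(X_k)$, $\mathbf\Psi_q(x)=\prod_{a\ge1}(1+q^{2a-1}x)^{-1}$, after the canonical identification of $\mathbf T_{\mathbf i'}$ and $\mathbf T_{\mathbf i}$ with the quantum torus algebra $\mathbf T_\Lambda$, $\Lambda=\mathbb Z[I]$ (with $X_i=X_{e_i}$, $X'_i=X_{e'_i}$, where $q^{-(v,w)}X_vX_w=X_{v+w}$, $(e_i,e_j)=\widehat\varepsilon_{ij}$, $e'_k=-e_k$, $e'_i=e_i+\max(0,\varepsilon_{ik})e_k$). In coordinates, $X'_k\mapsto X_k^{-1}$ and, for $i\neq k$, $$X'_i\mapsto X_i\prod_{a=1}^{|\varepsilon_{ik}|}(1+q_k^{2a-1}X_k)\ \text{ if }\varepsilon_{ik}\le0,\qquad X'_i\mapsto X_i\Bigl(\prod_{a=1}^{\varepsilon_{ik}}(1+q_k^{2a-1}X_k^{-1})\Bigr)^{-1}\ \text{ if }\varepsilon_{ik}\geq0.$$ Seed isomorphisms $\sigma$ act by $X'_{\sigma(i)}\mapsto X_i$. Groupoid. Let $\sigma_{ij}$ be the seed isomorphism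 induced by the transposition of $i$ and $j$. Special trivial seed cluster transformations are compositions of isomorphisms and the transformations $(\sigma_{ij}\circ\mu_i)^{h+2}$ for non-frozen $i\neq j$ with $\varepsilon_{ij}=-p\varepsilon_{ji}=-p$, where $h=2,3,4,6$ for $p=0,1,2,3$. $\widehat{\mathcal G}$ is the groupoid whose objects are seeds equivalent to the given one and whose morphisms are seed cluster transformations modulo the special trivial ones (with $\mu_k\circ\mu_k$ equal to the identity). $\mathrm{QPos}^*$ is the opposite of the category whose objects are quantum torus algebras with the antiautomorphism $\ast$ and whose morphisms are positive rational $\ast$-maps, i.e. homomorphisms of the non-commutative fraction fields commuting with $\ast$ (given on generators by subtraction-free expressions, i.e. expressions built from the generators $X_i^{\pm1}$ and powers of $q$ by addition, multiplication and inversion, such as $X_i\prod_{a=1}^{n}(1+q_k^{2a-1}X_k)$ and $X_i\bigl(\prod_{a=1}^{n}(1+q_k^{2a-1}X_k^{-1})\bigr)^{-1}$). The functor sends $\mathbf i$ to $\mathbf T_{\mathbf i}$, the mutation $\mathbf i\to\mathbf i'$ to $\mu_k^q$, and seed isomorphisms to the corresponding relabelling maps. *)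

(* Defs.v *)
From HB Require Import structures.
From mathcomp Require Import all_boot all_order all_algebra perm.
From mathcomp Require Import boolp finmap.
From mathcomp Require Import monalg.
From mathcomp Require Import ring.

Set Implicit Arguments.
Unset Strict Implicit.
Unset Printing Implicit Defensive.

Import Order.TTheory GRing.Theory Num.Theory.
Local Open Scope ring_scope.

Record seed (I : finType) := Seed {
  frozen : {set I};
  eps : I -> I -> rat;
  seed_d : I -> nat;
  eps_int : forall i j, ~~ ((i \in frozen) && (j \in frozen)) ->
    eps i j \is a Num.int;
  d_gt0 : forall i, (0 < seed_d i)%N;
  d_gcd : \big[gcdn/0%N]_i seed_d i = 1%N;
  eps_skew : forall i j, eps i j / (seed_d j)%:R = - (eps j i / (seed_d i)%:R) }.

Definition eps_hat (I : finType) (s : seed I) (i j : I) : rat :=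
  eps s i j / (seed_d s j)%:R.

Section Mutation.
Variables (I : finType) (s : seed I) (k : I).
Hypothesis k_mut : k \notin frozen s.

Definition mutate_eps (i j : I) : rat :=
  if (k == i) || (k == j) then - eps s i j
  else if eps s i k * eps s k j <= 0 then eps s i j
  else eps s i j + `|eps s i k| * eps s k j.

Fact mutate_eps_int i j : ~~ ((i \in frozen s) && (j \in frozen s)) ->
  mutate_eps i j \is a Num.int.
Proof.
move=> /(@eps_int _ s) ij; rewrite /mutate_eps; case: ifP => _.
  by rewrite rpredN.
have ik : eps s i k \is a Num.int.
  by apply: eps_int; rewrite (negPf k_mut) andbF.
have kj : eps s k j \is a Num.int by apply: eps_int; rewrite (negPf k_mut).
by case: ifP => // _; rewrite rpredD // rpredM // intr_nat // natr_norm_int.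
Qed.

Fact mutate_eps_skew i j :
  mutate_eps i j / (seed_d s j)%:R = - (mutate_eps j i / (seed_d s i)%:R).
Proof.
have pos l : 0 < (seed_d s l)%:R :> rat by rewrite ltr0n d_gt0.
have inv a b : eps s a b = - (eps s b a * ((seed_d s b)%:R / (seed_d s a)%:R)).
  have := eps_skew s a b => /(congr1 ( *%R^~ (seed_d s b)%:R)).
  rewrite divfK ?gt_eqF // => ->; rewrite mulNr; congr (- _).
  by rewrite -mulrA [_^-1 * _]mulrC.
have sgn : (eps s j k * eps s k i <= 0) = (eps s i k * eps s k j <= 0).
  rewrite (inv j k) (inv k i).
  have -> : - (eps s k j * ((seed_d s k)%:R / (seed_d s j)%:R)) *
            - (eps s i k * ((seed_d s i)%:R / (seed_d s k)%:R))
      = (eps s i k * eps s k j) * ((seed_d s i)%:R / (seed_d s j)%:R).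
    by field; rewrite !gt_eqF.
  by rewrite pmulr_lle0 // divr_gt0.
rewrite /mutate_eps orbC; case: ifP => _; first by rewrite !mulNr eps_skew.
rewrite sgn; case: leP => [_|pp]; first exact: eps_skew.
rewrite !mulrDl opprD eps_skew; congr (_ + _).
have e1 : `|eps s j k| = `|eps s k j| * ((seed_d s k)%:R / (seed_d s j)%:R).
  rewrite (inv j k) normrN normrM; congr (_ * _).
  by rewrite gtr0_norm // divr_gt0.
rewrite e1 (inv k i).
have e2 : `|eps s i k| * eps s k j = `|eps s k j| * eps s i k.
  have [a0|a0|a0] := ltgtP (eps s i k) 0; last by move: pp; rewrite a0 mul0r ltxx.
    by move: pp; rewrite nmulr_rgt0 // => b0; rewrite !ltr0_norm // !mulNr mulrC.
  by move: pp; rewrite pmulr_rgt0 // => b0; rewrite !gtr0_norm // mulrC.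
by rewrite e2; field; rewrite !gt_eqF.
Qed.

Definition mutate : seed I :=
  Seed mutate_eps_int (d_gt0 s) (d_gcd s) mutate_eps_skew.

End Mutation.

Lemma seed_eq (I : finType) (s t : seed I) :
  frozen s = frozen t -> eps s = eps t -> seed_d s = seed_d t -> s = t.
Proof.
case: s t => [f e m p1 p2 p3 p4] [f' e' m' q1 q2 q3 q4] /= ef ee em.
by subst; f_equal; exact: Prop_irrelevance.
Qed.

Lemma mutateK (I : finType) (s : seed I) k (hk : k \notin frozen s)
  (hk' : k \notin frozen (mutate hk)) : mutate hk' = s.
Proof.
apply: seed_eq => //=; apply/funext => i; apply/funext => j.
rewrite /mutate_eps /= /mutate_eps !eqxx orbT /=.
case: ifP => ij; first by rewrite ij opprK.
by rewrite ij mulrNN normrN; case: ifP => h; rewrite h // mulrN addrK.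
Qed.

Record seed_iso (I J : finType) (s : seed I) (t : seed J) (f : I -> J) : Prop :=
  SeedIso {
    iso_bij : bijective f;
    iso_frozen : forall i, (f i \in frozen t) = (i \in frozen s);
    iso_eps : forall i j, eps t (f i) (f j) = eps s i j;
    iso_d : forall i, seed_d t (f i) = seed_d s i }.

Lemma seed_iso_id (I : finType) (s : seed I) : seed_iso s s id.
Proof. by split => //; exists id. Qed.

Record any_seed := AnySeed { seed_index : finType; seed_of : seed seed_index }.

(* Formal compositions; they are identified by [transf_eq] below. *)
Inductive transf : any_seed -> any_seed -> Type :=
| Mut (I : finType) (s s' : seed I) (k : I) (k_mut : k \notin frozen s) :
    s' = mutate k_mut -> transf (AnySeed s) (AnySeed s')
| Iso (I J : finType) (s : seed I) (t : seed J) (f : I -> J) :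
    seed_iso s t f -> transf (AnySeed s) (AnySeed t)
| Comp (x y z : any_seed) : transf y z -> transf x y -> transf x z.

Definition transf_id (x : any_seed) : transf x x :=
  let: AnySeed J s := x in Iso (seed_iso_id s).

(* [sigma_mu_power i j n c] : c is the n-th power of sigma_ij o mu_i; the seed
   is different at each of the n stages, the index set is the same. *)
Inductive sigma_mu_power (I : finType) (i j : I) :
  nat -> forall s t : seed I, transf (AnySeed s) (AnySeed t) -> Prop :=
| SigmaMu0 (s : seed I) : sigma_mu_power i j 0 (transf_id (AnySeed s))
| SigmaMuS n (s t u v : seed I) (c : transf (AnySeed s) (AnySeed t))
    (i_mut : i \notin frozen t) (tu : u = mutate i_mut)
    (uv : seed_iso u v (tperm i j)) :
    sigma_mu_power i j n c ->
    sigma_mu_power i j n.+1 (Comp (Iso uv) (Comp (Mut tu) c)).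

Definition coxeter_number (p : nat) : nat := nth 0%N [:: 2; 3; 4; 6]%N p.

(* The closure of these loops under composition, in particular with
   isomorphisms, is taken in [transf_eq]; isomorphisms are not made trivial. *)
Definition special_trivial (I : finType) (s : seed I)
    (c : transf (AnySeed s) (AnySeed s)) : Prop :=
  exists i j p, [/\ (i \notin frozen s) && (j \notin frozen s),
    i != j, (p < 4)%N,
    eps s i j = - (p%:R * eps s j i) /\ eps s i j = - p%:R
  & sigma_mu_power i j (coxeter_number p + 2) c].

Inductive transf_eq : forall x y, transf x y -> transf x y -> Prop :=
| Teq_refl x y (a : transf x y) : transf_eq a a
| Teq_sym x y (a b : transf x y) : transf_eq a b -> transf_eq b a
| Teq_trans x y (a b c : transf x y) :
    transf_eq a b -> transf_eq b c -> transf_eq a c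
| Teq_comp x y z (a a' : transf y z) (b b' : transf x y) :
    transf_eq a a' -> transf_eq b b' -> transf_eq (Comp a b) (Comp a' b')
| Teq_assoc x y z w (a : transf z w) (b : transf y z) (c : transf x y) :
    transf_eq (Comp a (Comp b c)) (Comp (Comp a b) c)
| Teq_idl x y (a : transf x y) : transf_eq (Comp (transf_id y) a) a
| Teq_idr x y (a : transf x y) : transf_eq (Comp a (transf_id x)) a
| Teq_iso (I J K : finType) (s : seed I) (t : seed J) (u : seed K)
    (f : I -> J) (g : J -> K) (st : seed_iso s t f) (tu : seed_iso t u g)
    (su : seed_iso s u (g \o f)) :
    transf_eq (Comp (Iso tu) (Iso st)) (Iso su)
| Teq_mut (I : finType) (s s' : seed I) (k : I)
    (k_mut : k \notin frozen s) (k_mut' : k \notin frozen s')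
    (ss' : s' = mutate k_mut) (s's : s = mutate k_mut') :
    transf_eq (Comp (Mut s's) (Mut ss')) (transf_id (AnySeed s))
| Teq_special (I : finType) (s : seed I) (c : transf (AnySeed s) (AnySeed s)) :
    special_trivial c -> transf_eq c (transf_id (AnySeed s)).

Record category := Category {
  Ob : Type;
  Mor : Ob -> Ob -> Type;
  idmor : forall x, Mor x x;
  compm : forall x y z, Mor y z -> Mor x y -> Mor x z;
  compmA : forall x y z w (f : Mor z w) (g : Mor y z) (h : Mor x y),
    compm f (compm g h) = compm (compm f g) h;
  compm1l : forall x y (f : Mor x y), compm (idmor y) f = f;
  compm1r : forall x y (f : Mor x y), compm f (idmor x) = f }.

Arguments Mor : clear implicits.
Arguments idmor : clear implicits.

Definition opposite (C : category) : category :=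
  @Category (Ob C) (fun x y => Mor C y x) (idmor C)
    (fun x y z f g => compm g f)
    (fun x y z w f g h => esym (compmA h g f))
    (fun x y f => compm1r f) (fun x y f => compm1l f).

Record is_functor (C D : category) (F : Ob C -> Ob D)
    (Fmap : forall x y, Mor C x y -> Mor D (F x) (F y)) : Prop := IsFunctor {
  functor1 : forall x, Fmap x x (idmor C x) = idmor D (F x);
  functorM : forall x y z (f : Mor C y z) (g : Mor C x y),
    Fmap x z (compm f g) = compm (Fmap y z f) (Fmap x y g) }.

Definition is_groupoid (C : category) : Prop :=
  forall x y (f : Mor C x y), exists g : Mor C y x,
    compm g f = idmor C x /\ compm f g = idmor C y.

(* Equivalence classes; [{eq_quot _}] needs a choiceType, and [transf] lives in
   a universe above the one of finType. *)
Definition transf_class (x y : any_seed) :=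
  {A : transf x y -> Prop | exists a, A = transf_eq a}.

Definition class_of_transf x y (a : transf x y) : transf_class x y :=
  exist _ (transf_eq a) (ex_intro _ a erefl).

Definition class_repr x y (A : transf_class x y) : transf x y :=
  sval (cid (svalP A)).

Lemma class_eqP x y (a b : transf x y) :
  class_of_transf a = class_of_transf b <-> transf_eq a b.
Proof.
split=> [[e]|ab]; first by rewrite e; exact: Teq_refl.
have e : transf_eq a = transf_eq b.
  apply/funext => c; apply/propext; split; apply: Teq_trans => //.
  exact: Teq_sym.
rewrite /class_of_transf; move: (ex_intro _ a _) (ex_intro _ b _) => /=.
by rewrite e => p q; congr exist; exact: Prop_irrelevance.
Qed.

Lemma class_reprK x y (A : transf_class x y) :
  class_of_transf (class_repr A) = A.
Proof.
rewrite /class_repr; case: (cid _) => a /=; case: A => A pA /= e; subst A.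
by congr exist; exact: Prop_irrelevance.
Qed.

Definition class_comp x y z (a : transf_class y z) (b : transf_class x y) :
  transf_class x z := class_of_transf (Comp (class_repr a) (class_repr b)).

Lemma class_compE x y z (a : transf y z) (b : transf x y) :
  class_comp (class_of_transf a) (class_of_transf b)
    = class_of_transf (Comp a b).
Proof.
by apply/class_eqP/Teq_comp; apply/class_eqP; rewrite class_reprK.
Qed.

Definition equivalent (x y : any_seed) : Prop := inhabited (transf x y).

Section SpecialGroupoid.
Variable x0 : any_seed.
Let ob := {x : any_seed | equivalent x0 x}.

Fact class_compA (x y z w : ob) (a : transf_class (sval z) (sval w))
    (b : transf_class (sval y) (sval z)) (c : transf_class (sval x) (sval y)) :
  class_comp a (class_comp b c) = class_comp (class_comp a b) c.
Proof.
rewrite -(class_reprK a) -(class_reprK b) -(class_reprK c) !class_compE.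
exact/class_eqP/Teq_assoc.
Qed.

Fact class_comp1l (x y : ob) (a : transf_class (sval x) (sval y)) :
  class_comp (class_of_transf (transf_id (sval y))) a = a.
Proof.
rewrite -[in LHS](class_reprK a) class_compE -[RHS]class_reprK.
exact/class_eqP/Teq_idl.
Qed.

Fact class_comp1r (x y : ob) (a : transf_class (sval x) (sval y)) :
  class_comp a (class_of_transf (transf_id (sval x))) = a.
Proof.
rewrite -[in LHS](class_reprK a) class_compE -[RHS]class_reprK.
exact/class_eqP/Teq_idr.
Qed.

Definition special_groupoid : category :=
  @Category ob (fun x y => transf_class (sval x) (sval y))
    (fun x => class_of_transf (transf_id (sval x)))
    (fun x y z => @class_comp (sval x) (sval y) (sval z))
    class_compA class_comp1l class_comp1r.

Lemma special_groupoidP : is_groupoid special_groupoid.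
Proof.
suff inv x y (a : transf x y) : exists b : transf y x,
    transf_eq (Comp b a) (transf_id x) /\ transf_eq (Comp a b) (transf_id y).
  move=> x y f; have [b [ba ab]] := inv _ _ (class_repr f).
  exists (class_of_transf b) => /=; rewrite -(class_reprK f) !class_compE.
  by split; apply/class_eqP.
elim: a => [I s s' k k_mut ss'|I J s t f st
  |x1 y1 z1 a [a' [a'a aa']] b [b' [b'b bb']]].
- have k_mut' : k \notin frozen s' by rewrite ss'.
  have s's : s = mutate k_mut' by subst s'; rewrite mutateK.
  by exists (Mut s's); split; exact: Teq_mut.
- have [[g fK gK] ff fe fd] := st.
  have ts : seed_iso t s g.
    split; first by exists f.
    + by move=> i; rewrite -ff gK.
    + by move=> i j; rewrite -fe !gK.
    + by move=> i; rewrite -fd gK.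
  have gf : g \o f = id by apply/funext => i /=.
  have fg : f \o g = id by apply/funext => i /=.
  exists (Iso ts); split; rewrite /=.
  + move: (seed_iso_id s); rewrite -{1 2}gf => h; exact: Teq_iso.
  + move: (seed_iso_id t); rewrite -{1 2}fg => h; exact: Teq_iso.
- exists (Comp b' a'); split.
  + apply: Teq_trans (Teq_sym (Teq_assoc _ _ _)) _.
    apply: Teq_trans b'b; apply: Teq_comp; first exact: Teq_refl.
    apply: Teq_trans (Teq_assoc _ _ _) _.
    apply: Teq_trans (Teq_idl _); apply: Teq_comp => //; exact: Teq_refl.
  + apply: Teq_trans (Teq_sym (Teq_assoc _ _ _)) _.
    apply: Teq_trans aa'; apply: Teq_comp; first exact: Teq_refl.
    apply: Teq_trans (Teq_assoc _ _ _) _.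
    apply: Teq_trans (Teq_idl _); apply: Teq_comp => //; exact: Teq_refl.
Qed.

End SpecialGroupoid.

(* The quantum torus over Z[t, t^-1] of an integral form B on the lattice Z^I.
   Its Z-basis is made of the monomials t^m X_v, encoded by the pairs (m, v),
   with t^m X_v * t^n X_w = t^(m + n + B(v, w)) X_(v + w).
   For a seed, t stands for q^(1/N) and B for N times the form (e_i, e_j), so
   that q^-(v, w) X_v X_w = X_(v + w). *)
Definition qmon (I : finType) : Type := int * {ffun I -> int}.
HB.instance Definition _ I := Choice.on (qmon I).

Definition qtorus (I : finType) (B : I -> I -> int) : Type :=
  {malg int[qmon I]}.
HB.instance Definition _ I B := GRing.Zmodule.on (@qtorus I B).

Definition qform (I : finType) (B : I -> I -> int)
    (v w : {ffun I -> int}) : int :=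
  \sum_i \sum_j v i * w j * B i j.

Definition qmon_mul (I : finType) (B : I -> I -> int) (a b : qmon I) : qmon I :=
  (a.1 + b.1 + qform B a.2 b.2, a.2 + b.2).

(* The operations below are locked only to keep unification fast. *)
HB.lock Definition qmono (I : finType) (B : I -> I -> int) (c : int)
    (a : qmon I) : qtorus B := << c *g a >>.

HB.lock Definition qtorus_mul (I : finType) (B : I -> I -> int)
    (f g : qtorus B) : qtorus B :=
  \sum_(a <- msupp f) \sum_(b <- msupp g)
    qmono B (f@_a * g@_b) (qmon_mul B a b).

(* The additive map t^m X_v |-> t^-m X_v. *)
HB.lock Definition qstar (I : finType) (B : I -> I -> int)
    (f : qtorus B) : qtorus B :=
  \sum_(a <- msupp f) qmono B f@_a (- a.1, a.2).

Section QuantumTorus.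
Variables (I : finType) (B : I -> I -> int).
Local Notation qmon := (qmon I).
Local Notation qtorus := (qtorus B).
Local Notation qform := (qform B).
Local Notation qmon_mul := (qmon_mul B).
Local Notation qmono := (qmono B).
Local Notation qtorus_mul := (@qtorus_mul I B).
Local Notation qstar := (@qstar I B).

Definition qmon_one : qmon := (0, 0).

Fact qformDl u v w : qform (u + v) w = qform u w + qform v w.
Proof.
rewrite -big_split; apply: eq_bigr => i _ /=; rewrite -big_split.
by apply: eq_bigr => j _; rewrite ffunE !mulrDl.
Qed.

Fact qformDr u v w : qform u (v + w) = qform u v + qform u w.
Proof.
rewrite -big_split; apply: eq_bigr => i _ /=; rewrite -big_split.
by apply: eq_bigr => j _; rewrite ffunE mulrDr mulrDl.
Qed.

Fact qform0l v : qform 0 v = 0.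
Proof. by apply: (addrI (qform 0 v)); rewrite -qformDl !addr0. Qed.

Fact qform0r v : qform v 0 = 0.
Proof. by apply: (addrI (qform v 0)); rewrite -qformDr !addr0. Qed.

Fact qmon_mulA : associative qmon_mul.
Proof.
move=> [m u] [n v] [p w]; rewrite /qmon_mul /= qformDl qformDr; congr pair.
  by ring.
exact: addrA.
Qed.

Fact qmon_mul1l : left_id qmon_one qmon_mul.
Proof. by case=> m u; rewrite /qmon_mul /= qform0l !add0r addr0. Qed.

Fact qmon_mul1r : right_id qmon_one qmon_mul.
Proof. by case=> m u; rewrite /qmon_mul /= qform0r !addr0. Qed.

Implicit Types f g h : qtorus.

Definition qtorus_one : qtorus := qmono 1 qmon_one.

Fact qmono0 a : qmono 0 a = 0.
Proof. by rewrite qmono.unlock monalgU0. Qed.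

Fact qmonoD x y a : qmono (x + y) a = qmono x a + qmono y a.
Proof. by rewrite qmono.unlock monalgUD. Qed.

Fact qmonoE x a : (qmono x a)@_a = x.
Proof. by rewrite qmono.unlock mcoeffUU. Qed.

Fact qmono_supp x a : (msupp (qmono x a) `<=` [fset a])%fset.
Proof. by rewrite qmono.unlock msuppU_le. Qed.

Lemma qtorusE f : f = \sum_(a <- msupp f) qmono f@_a a.
Proof. by rewrite [LHS]monalgE qmono.unlock. Qed.

Fact qtorus_mulE f g : qtorus_mul f g =
  \sum_(a <- msupp f) \sum_(b <- msupp g) qmono (f@_a * g@_b) (qmon_mul a b).
Proof. by rewrite qtorus_mul.unlock. Qed.

Fact qtorus_mulEw (A D : {fset qmon}) f g :
  (msupp f `<=` A)%fset -> (msupp g `<=` D)%fset ->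
  qtorus_mul f g =
    \sum_(a <- A) \sum_(b <- D) qmono (f@_a * g@_b) (qmon_mul a b).
Proof.
move=> fA gD; rewrite qtorus_mulE.
rewrite (big_fset_incl _ fA) /= => [|a _ /mcoeff_outdom ->]; last first.
  by rewrite big1 // => b _; rewrite mul0r qmono0.
apply: eq_bigr => a _; rewrite (big_fset_incl _ gD) //= => b _.
by move=> /mcoeff_outdom ->; rewrite mulr0 qmono0.
Qed.

Fact qtorus_mulDl : left_distributive qtorus_mul +%R.
Proof.
move=> f g h; pose A := (msupp f `|` msupp g)%fset.
rewrite (@qtorus_mulEw A (msupp h) (f + g)) ?msuppD_le //.
rewrite (@qtorus_mulEw A (msupp h) f) ?fsubsetUl //.
rewrite (@qtorus_mulEw A (msupp h) g) ?fsubsetUr //.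
rewrite -big_split; apply: eq_bigr => a _ /=; rewrite -big_split.
by apply: eq_bigr => b _; rewrite mcoeffD mulrDl qmonoD.
Qed.

Fact qtorus_mulDr : right_distributive qtorus_mul +%R.
Proof.
move=> h f g; pose A := (msupp f `|` msupp g)%fset.
rewrite (@qtorus_mulEw (msupp h) A h (f + g)) ?msuppD_le //.
rewrite (@qtorus_mulEw (msupp h) A h f) ?fsubsetUl //.
rewrite (@qtorus_mulEw (msupp h) A h g) ?fsubsetUr //.
rewrite -big_split; apply: eq_bigr => a _ /=; rewrite -big_split.
by apply: eq_bigr => b _; rewrite mcoeffD mulrDr qmonoD.
Qed.

Fact qtorus_mulU (x y : int) (a b : qmon) :
  qtorus_mul (qmono x a) (qmono y b) = qmono (x * y) (qmon_mul a b).
Proof.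
rewrite (@qtorus_mulEw [fset a]%fset [fset b]%fset) ?qmono_supp //.
by rewrite !big_seq_fset1 !qmonoE.
Qed.

Fact qtorus_mul0l f : qtorus_mul 0 f = 0.
Proof. by rewrite qtorus_mulE msupp0 big_seq_fset0. Qed.

Fact qtorus_mul0r f : qtorus_mul f 0 = 0.
Proof. by rewrite qtorus_mulE msupp0 big1 // => a _; rewrite big_seq_fset0. Qed.

Fact qtorus_suml (T : Type) (r : seq T) (F : T -> qtorus) g :
  qtorus_mul (\sum_(i <- r) F i) g = \sum_(i <- r) qtorus_mul (F i) g.
Proof.
exact: (big_morph (qtorus_mul^~ g) (fun x y => qtorus_mulDl x y g)
                  (qtorus_mul0l g)).
Qed.

Fact qtorus_sumr (T : Type) (r : seq T) (F : T -> qtorus) g :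
  qtorus_mul g (\sum_(i <- r) F i) = \sum_(i <- r) qtorus_mul g (F i).
Proof.
exact: (big_morph (qtorus_mul g) (qtorus_mulDr g) (qtorus_mul0r g)).
Qed.

Fact qtorus_mulEl f g :
  qtorus_mul f g = \sum_(a <- msupp f) qtorus_mul (qmono f@_a a) g.
Proof. by rewrite [f in LHS]qtorusE qtorus_suml. Qed.

Fact qtorus_mulEr f g :
  qtorus_mul f g = \sum_(a <- msupp g) qtorus_mul f (qmono g@_a a).
Proof. by rewrite [g in LHS]qtorusE qtorus_sumr. Qed.

Fact qtorus_mulA : associative qtorus_mul.
Proof.
move=> f g h; rewrite (qtorus_mulEl f (qtorus_mul g h)) (qtorus_mulEl f g).
rewrite (qtorus_suml _ _ h); apply: eq_bigr => a _.
set u := (qmono _ a); rewrite (qtorus_mulEl g h) (qtorus_mulEr u g).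
rewrite (qtorus_suml _ _ h) (qtorus_sumr _ _ u); apply: eq_bigr => b _.
set v := (qmono _ b); rewrite (qtorus_mulEr v h) (qtorus_mulEr _ h).
rewrite (qtorus_sumr _ _ u); apply: eq_bigr => c _.
by rewrite !qtorus_mulU mulrA qmon_mulA.
Qed.

Fact qtorus_mul1l : left_id qtorus_one qtorus_mul.
Proof.
move=> f; rewrite [f in LHS]qtorusE qtorus_sumr [RHS]qtorusE.
by apply: eq_bigr => a _; rewrite qtorus_mulU mul1r qmon_mul1l.
Qed.

Fact qtorus_mul1r : right_id qtorus_one qtorus_mul.
Proof.
move=> f; rewrite [f in LHS]qtorusE qtorus_suml [RHS]qtorusE.
by apply: eq_bigr => a _; rewrite qtorus_mulU mulr1 qmon_mul1r.
Qed.

Fact qtorus_one_neq0 : qtorus_one != 0.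
Proof. by apply/eqP => /(congr1 (mcoeff qmon_one)); rewrite qmonoE mcoeff0. Qed.

HB.instance Definition _ := GRing.Zmodule_isNzRing.Build qtorus
  qtorus_mulA qtorus_mul1l qtorus_mul1r qtorus_mulDl qtorus_mulDr
  qtorus_one_neq0.

Definition qpow (m : int) : qtorus := qmono 1 (m, 0).

Definition qgen (i : I) : qtorus := qmono 1 (0, [ffun j => (i == j)%:R]).

Fact qgen_rel i j : qpow (- B i j) * (qgen i * qgen j)
  = qpow (- B j i) * (qgen j * qgen i).
Proof.
have form (k l : I) : qform [ffun j => (k == j)%:R] [ffun j => (l == j)%:R]
    = B k l.
  rewrite /qform (bigD1 k) //= (bigD1 l) //= !ffunE !eqxx !mul1r.
  rewrite big1 ?big1 ?addr0 // => [x xk|x xl].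
    by rewrite big1 // => y _; rewrite !ffunE eq_sym (negPf xk) !mul0r.
  by rewrite !ffunE [l == x]eq_sym (negPf xl) mulr0 mul0r.
have mulU (a b : qmon) :
    qmono 1 a * qmono 1 b = qmono 1 (qmon_mul a b).
  by rewrite -[LHS]/(qtorus_mul _ _) qtorus_mulU mulr1.
rewrite !mulU /qmon_mul /= !form !qform0l !add0r.
by rewrite !addr0 !addNr [X in (_, X)]addrC.
Qed.

Fact qstarE f : qstar f = \sum_(a <- msupp f) qmono f@_a (- a.1, a.2).
Proof. by rewrite qstar.unlock. Qed.

Fact qstarEw (A : {fset qmon}) f : (msupp f `<=` A)%fset ->
  qstar f = \sum_(a <- A) qmono f@_a (- a.1, a.2).
Proof.
move=> fA; rewrite qstarE (big_fset_incl _ fA) //= => a _ /mcoeff_outdom ->.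
by rewrite qmono0.
Qed.

Fact qstarD : {morph qstar : f g / f + g}.
Proof.
move=> f g; pose A := (msupp f `|` msupp g)%fset.
rewrite (@qstarEw A (f + g)) ?msuppD_le //.
rewrite (@qstarEw A f) ?fsubsetUl // (@qstarEw A g) ?fsubsetUr //.
by rewrite -big_split; apply: eq_bigr => a _; rewrite mcoeffD qmonoD.
Qed.

Fact qstar0 : qstar 0 = 0.
Proof. by rewrite qstarE msupp0 big_seq_fset0. Qed.

Fact qstarU (x : int) (a : qmon) :
  qstar (qmono x a) = qmono x (- a.1, a.2).
Proof.
by rewrite (@qstarEw [fset a]%fset) ?qmono_supp // big_seq_fset1 qmonoE.
Qed.

Fact qstar_sum (T : Type) (r : seq T) (F : T -> qtorus) :
  qstar (\sum_(i <- r) F i) = \sum_(i <- r) qstar (F i).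
Proof. exact: (big_morph qstar qstarD qstar0). Qed.

Lemma qstarK : involutive qstar.
Proof.
move=> f; rewrite (qstarE f) qstar_sum [RHS]qtorusE; apply: eq_bigr => -[m v] _.
by rewrite qstarU /= opprK.
Qed.

Lemma qstarM : (forall i j, B i j = - B j i) ->
  forall f g, qstar (f * g) = qstar g * qstar f.
Proof.
move=> skew f g; have formC v w : qform v w = - qform w v.
  rewrite /qform exchange_big -sumrN; apply: eq_bigr => i _ /=.
  rewrite -sumrN; apply: eq_bigr => j _.
  by rewrite skew mulrN [v j * _]mulrC.
rewrite -[f * g]/(qtorus_mul f g) -[RHS]/(qtorus_mul (qstar g) (qstar f)).
rewrite (qtorus_mulE f g) qstar_sum (qstarE f).
rewrite (qtorus_sumr _ _ (qstar g)); apply: eq_bigr => a _.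
rewrite qstar_sum (qstarE g); set u := qmono _ (- a.1, _).
rewrite (qtorus_suml _ _ u) {}/u.
apply: eq_bigr => b _; rewrite qstarU qtorus_mulU mulrC /qmon_mul /=.
congr (qmono _ (_, _)); last exact: addrC.
by rewrite formC; ring.
Qed.

End QuantumTorus.

(* A quantum torus is an Ore domain; its fraction field is determined up to
   unique isomorphism by the properties below. *)
Record fraction_field (T : nzRingType) := FractionField {
  frac_sort :> unitRingType;
  frac_inj : {rmorphism T -> frac_sort};
  frac_injP : injective frac_inj;
  frac_unit : forall x : frac_sort, x != 0 -> x \is a GRing.unit;
  fracP : forall x : frac_sort,
    exists ab : T * T, ab.2 != 0 /\ x = frac_inj ab.1 / frac_inj ab.2 }.

Section FractionStar.
Variables (I : finType) (B : I -> I -> int) (K : fraction_field (qtorus B)).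

Definition fgen (i : I) : K := frac_inj K (qgen B i).

Definition fpow (m : int) : K := frac_inj K (qpow B m).

(* The image of a b^-1 under the antiautomorphism is star(b)^-1 star(a); it
   does not depend on the fraction chosen to represent x. *)
Definition fstar (x : K) : K :=
  let ab := sval (cid (fracP x)) in
  (frac_inj K (qstar ab.2))^-1 * frac_inj K (qstar ab.1).

Lemma fstarE (a b : qtorus B) : (forall i j, B i j = - B j i) -> b != 0 ->
  fstar (frac_inj K a / frac_inj K b)
    = (frac_inj K (qstar b))^-1 * frac_inj K (qstar a).
Proof.
move=> skew b0; rewrite /fstar; case: cid => -[a' b'] /= [b'0 ab].
have injU (c : qtorus B) : c != 0 -> frac_inj K c \is a GRing.unit.
  move=> c0; rewrite frac_unit // -(rmorph0 (frac_inj K)).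
  by rewrite (inj_eq (@frac_injP _ K)).
have [[u v] /= [v0 uv]] := fracP ((frac_inj K b)^-1 * frac_inj K b').
have bu : b * u = b' * v.
  apply: (@frac_injP _ K); rewrite !rmorphM.
  by rewrite -[frac_inj K u](divrK (injU _ v0)) -uv mulrA mulVKr ?injU.
have au : a * u = a' * v.
  apply: (@frac_injP _ K); rewrite !rmorphM.
  rewrite -[frac_inj K a](divrK (injU _ b0)) ab -mulrA -rmorphM bu rmorphM.
  by rewrite mulrA divrK ?injU.
have u0 : u != 0.
  apply/eqP => u0; have : frac_inj K (b' * v) \is a GRing.unit.
    by rewrite rmorphM unitrMr ?injU.
  by rewrite -bu u0 mulr0 rmorph0 unitr0.
have star0 (c : qtorus B) : c != 0 -> qstar c != 0.
  by apply: contra_neq => c0; rewrite -[c]qstarK c0 qstar0.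
have U (c : qtorus B) (c0 : c != 0) := injU _ (star0 c c0).
have E1 : frac_inj K (qstar u) * frac_inj K (qstar b)
    = frac_inj K (qstar v) * frac_inj K (qstar b').
  by rewrite -!rmorphM -!qstarM // bu.
have E2 : frac_inj K (qstar u) * frac_inj K (qstar a)
    = frac_inj K (qstar v) * frac_inj K (qstar a').
  by rewrite -!rmorphM -!qstarM // au.
apply: (canRL (mulKr (U _ b0))); rewrite -[LHS](mulKr (U _ u0)).
by rewrite [_ (qstar u) * _]mulrA E1 -mulrA mulVKr ?U // -E2 mulKr ?U.
Qed.

Inductive subtraction_free : K -> Prop :=
| SfGen i : subtraction_free (fgen i)
| SfPow m : subtraction_free (fpow m)
| SfAdd x y : subtraction_free x -> subtraction_free y ->
    subtraction_free (x + y)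
| SfMul x y : subtraction_free x -> subtraction_free y ->
    subtraction_free (x * y)
| SfInv x : subtraction_free x -> subtraction_free x^-1.

End FractionStar.

Record qpos_ob := QPosOb {
  qindex : finType;
  qB : qindex -> qindex -> int;
  qB_skew : forall i j, qB i j = - qB j i;
  qfrac :> fraction_field (qtorus qB) }.

Record is_positive_star_map (S T : qpos_ob) (f : S -> T) : Prop :=
  IsPositiveStarMap {
    psm_zmod : zmod_morphism f;
    psm_monoid : monoid_morphism f;
    psm_pow : forall m, f (fpow S m) = fpow T m;
    psm_star : forall x, f (fstar x) = fstar (f x);
    psm_pos : forall i, subtraction_free (f (fgen S i)) }.

Record qpos_hom (S T : qpos_ob) := QPosHom {
  qmap :> S -> T;
  qmapP : is_positive_star_map qmap }.

Lemma qpos_hom_eq S T (f g : qpos_hom S T) : qmap f = qmap g -> f = g.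
Proof.
case: f g => [f fP] [g gP] /= fg; subst g; congr QPosHom.
exact: Prop_irrelevance.
Qed.

Fact qpos_id_subproof S : is_positive_star_map (@id (qfrac S)).
Proof. by split => // i; constructor. Qed.

Definition qpos_id S : qpos_hom S S := QPosHom (qpos_id_subproof S).

Lemma psm_subtraction_free S T (f : qpos_hom S T) (x : S) :
  subtraction_free x -> subtraction_free (f x).
Proof.
case: f => f [fB [f1 fM] fq fs fp] /=.
have f0 : f 0 = 0 by rewrite -[in LHS](subrr 0) fB subrr.
have fN y : f (- y) = - f y by rewrite -[in LHS](sub0r y) fB f0 sub0r.
elim=> [i|m|y z _ yP _ zP|y z _ yP _ zP|y _ yP]; first exact: fp.
- by rewrite fq; constructor.
- by rewrite -[z]opprK fB fN opprK; constructor.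
- by rewrite fM; constructor.
have [y0|y0] := eqVneq y 0; first by move: yP; rewrite y0 invr0.
have yU := frac_unit y0.
have fyV : f y^-1 * f y = 1 by rewrite -fM mulVr.
suff -> : f y^-1 = (f y)^-1 by constructor.
have fyU : f y \is a GRing.unit.
  apply: frac_unit; apply: contra_eq_neq fyV => ->.
  by rewrite mulr0 eq_sym oner_neq0.
by rewrite -[LHS](mulrK fyU) fyV mul1r.
Qed.

Fact qpos_comp_subproof S T U (f : qpos_hom T U) (g : qpos_hom S T) :
  is_positive_star_map (f \o g).
Proof.
have [fB [f1 fM] fq fs fp] := qmapP f; have [gB [g1 gM] gq gs gp] := qmapP g.
split => [x y|||x|i] /=.
- by rewrite gB fB.
- by split=> [|x y] /=; rewrite ?g1 ?f1 ?gM ?fM.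
- by move=> m; rewrite gq fq.
- by rewrite gs fs.
- exact/psm_subtraction_free/gp.
Qed.

Definition qpos_comp S T U (f : qpos_hom T U) (g : qpos_hom S T) :
  qpos_hom S U := QPosHom (qpos_comp_subproof f g).

Fact qpos_compA S T U V (f : qpos_hom U V) (g : qpos_hom T U)
    (h : qpos_hom S T) :
  qpos_comp f (qpos_comp g h) = qpos_comp (qpos_comp f g) h.
Proof. exact: qpos_hom_eq. Qed.

Fact qpos_comp1l S T (f : qpos_hom S T) : qpos_comp (qpos_id T) f = f.
Proof. exact: qpos_hom_eq. Qed.

Fact qpos_comp1r S T (f : qpos_hom S T) : qpos_comp f (qpos_id S) = f.
Proof. exact: qpos_hom_eq. Qed.

Definition QPos : category :=
  Category qpos_compA qpos_comp1l qpos_comp1r.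

Definition QPos_star : category := opposite QPos.

(* N * eps_hat, for an N which makes it integral. *)
Definition seed_form (N : nat) (I : finType) (s : seed I) (i j : I) : int :=
  numq (N%:R * eps_hat s i j).

Fact seed_form_skew N I (s : seed I) i j :
  seed_form N s i j = - seed_form N s j i.
Proof. by rewrite /seed_form /eps_hat eps_skew mulrN numqN. Qed.

Definition seed_qtorus (N : nat) (x : any_seed)
    (K : fraction_field (qtorus (seed_form N (seed_of x)))) : Ob QPos_star :=
  @QPosOb (seed_index x) _ (seed_form_skew N (seed_of x)) K.

Section QuantumMutation.
Variables (N : nat) (I : finType) (s s' : seed I) (k : I).
Variables (K : fraction_field (qtorus (seed_form N s))).
Variables (K' : fraction_field (qtorus (seed_form N s'))).

(* q_k^m, where q = t^N and q_k = q^(1/d_k). *)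
Definition qk_pow (m : nat) : K := fpow K (m * (N %/ seed_d s k))%:Z.

Definition quantum_mutation_image (i : I) : K :=
  let n := `|numq (eps s i k)|%N in
  let X := fgen K k in
  if i == k then X^-1
  else if eps s i k <= 0 then
    fgen K i * \prod_(1 <= a < n.+1) (1 + qk_pow (2 * a - 1) * X)
  else
    fgen K i * (\prod_(1 <= a < n.+1) (1 + qk_pow (2 * a - 1) * X^-1))^-1.

(* Conjugation by the quantum dilogarithm of X_k, on the generators. *)
Definition is_quantum_mutation (f : K' -> K) : Prop :=
  forall i, f (fgen K' i) = quantum_mutation_image i.

End QuantumMutation.

Definition is_relabelling (N : nat) (I J : finType) (s : seed I) (t : seed J)
    (sigma : I -> J) (K : fraction_field (qtorus (seed_form N s)))
    (K' : fraction_field (qtorus (seed_form N t))) (f : K' -> K) : Prop :=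
  forall i, f (fgen K' (sigma i)) = fgen K i.

Definition seed_ob (x0 : any_seed) (I : finType) (s : seed I)
    (hs : equivalent x0 (AnySeed s)) : Ob (special_groupoid x0) :=
  exist _ (AnySeed s) hs.

(* Main.v *)
From HB Require Import structures.
Require Import Defs.
From mathcomp Require Import all_boot all_order all_algebra perm.
From mathcomp Require Import boolp finmap.
From mathcomp Require Import monalg.
From mathcomp Require Import ring lra zify.

Set Implicit Arguments.
Unset Strict Implicit.
Unset Printing Implicit Defensive.

Import Order.TTheory GRing.Theory Num.Theory.
Local Open Scope ring_scope.

(** Every formal composition of mutations and seed isomorphisms yields a
    homomorphism between fraction fields, in the opposite direction.  Two
    things have to be seen: a mutation does give a homomorphism with the
    required properties, and the compositions that are declared trivial give
    the identity.

    Mutations.  Let X_v be the monomial of the lattice vector v, let k be the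
    mutated vertex, q = q_k and y = X_k^-1.  Conjugation by the inverse of the
    quantum dilogarithm of y sends X_v to X_v L(n)^-1, where n is the pairing of
    v with e_k and L(n) is the product of the 1 + q^(2a+1) y for 0 <= a < n,
    continued to negative n as an inverse product ([ladder]).  Moving X_v across
    a factor shifts the index a by n, so that multiplicativity is the cocycle
    rule L(m + n) = L(m) L'(n), with L' the shifted product ([ladderD]).
    Composed with the linear map e_k |-> - e_k, e_i |-> e_i + max(0, - eps_ik) e_k,
    which carries the mutated form to the original one ([qform_lat_mut]), this
    has the prescribed values on the generators ([mutation_rep_basis]).  It
    commutes with the star since the star turns L(n) into L(- n)^-1
    ([ladder_star]); it is injective since, once denominators are cleared,
    conjugation by the dilogarithm itself undoes it ([mutation_rep_inj]), and
    so it extends to the fraction field ([frac_ext]).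

    Relations.  A homomorphism is determined by its values on the generators.
    For the square of a mutation, and for sigma_ij o mu_i when eps_ij = 0, the
    factors acquired by a generator cancel in pairs ([mut_factorN]).  Let now
    p = - eps_ij be 1, 2 or 3, and let z_n be the inverse of the image of X_i
    after n steps, with z_(-1) = X_j.  These elements satisfy the rank two
    Y-system of type A2, B2 or G2.  Its solutions are Laurent polynomials in
    z_(-1) and z_0 whose coefficients are natural numbers; they are written
    down explicitly and the recursion is verified by computation ([sol_A2P],
    [sol_B2P], [sol_G2P]).  The solution has period h + 2, hence X_i and X_j
    are fixed.

    For the other generators, carry a lattice vector v along the mutations.
    Each step rotates the pairings of v with e_i and e_j by a quarter turn,
    and multiplies the image of X_v by one inverse product L(n)^-1 that
    depends on these pairings only ([chain], [stateS]). If both pairings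
    vanish then X_v is never changed, and v comes back to itself because the
    form is non-degenerate on the plane of e_i and e_j.  Adding multiples of
    e_i and e_j to e_l, and perhaps changing the sign, one reaches a vector
    whose pairings are (0, 0) or (0, -1). The second case arises for p = 2 and
    p = 3 only; there the factors acquired are evaluated by factorising
    Laurent polynomials in z_(-1) and z_0 ([B2_factor], [G2_factor3],
    [G2_factor5]). *)

(** * Lattice vectors and skew forms *)

Definition basis_vec (I : finType) (i : I) : {ffun I -> int} :=
  [ffun j => (i == j)%:R].

Lemma lattice_ind (I : finType) (P : {ffun I -> int} -> Prop) :
  (forall u v, P u -> P v -> P (u - v)) -> (forall i, P (basis_vec i)) ->
  P 0 -> forall v, P v.
Proof.
move=> PB Pe P0 v.
have PN u : P u -> P (- u) by rewrite -sub0r; apply: PB.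
have PD u w : P u -> P w -> P (u + w) by move=> ? ?; rewrite -[w]opprK; apply/PB/PN.
have PM u n : P u -> P (u *+ n).
  by move=> Pu; elim: n => [|n IH]; rewrite ?mulr0n ?mulrS //; apply: PD.
have -> : v = \sum_i basis_vec i *~ v i.
  apply/ffunP => j; rewrite sum_ffunE (bigD1 j) //= big1 => [|i ij].
    by rewrite addr0 ffunMzE ffunE eqxx intz.
  by rewrite ffunMzE ffunE (negPf ij) mul0rz.
apply: big_ind => // i _; case: (v i) => n; first exact/PM/Pe.
by rewrite NegzE mulrNz; apply/PN/PM/Pe.
Qed.

Lemma qform_basis (I : finType) (B : I -> I -> int) v j :
  qform B v (basis_vec j) = \sum_i v i * B i j.
Proof.
apply: eq_bigr => i _; rewrite (bigD1 j) //= big1 => [|l lj].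
  by rewrite ffunE eqxx mulr1 addr0.
by rewrite ffunE eq_sym (negPf lj) mulr0 mul0r.
Qed.

Section Form.
Variables (I : finType) (B : I -> I -> int).

Lemma qform_basis2 i j : qform B (basis_vec i) (basis_vec j) = B i j.
Proof.
rewrite qform_basis (bigD1 i) //= big1 ?addr0 => [|l li].
  by rewrite ffunE eqxx mul1r.
by rewrite ffunE eq_sym (negPf li) mul0r.
Qed.

Lemma qformNl v w : qform B (- v) w = - qform B v w.
Proof. by apply: (addrI (qform B v w)); rewrite -qformDl !subrr qform0l. Qed.

Lemma qformNr v w : qform B v (- w) = - qform B v w.
Proof. by apply: (addrI (qform B v w)); rewrite -qformDr !subrr qform0r. Qed.

Hypothesis skew : forall i j, B i j = - B j i.

Lemma qformC v w : qform B v w = - qform B w v.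
Proof.
rewrite /qform exchange_big -sumrN; apply: eq_bigr => i _ /=.
rewrite -sumrN; apply: eq_bigr => j _.
by rewrite skew mulrN [v j * _]mulrC.
Qed.

Lemma qformvv v : qform B v v = 0.
Proof. by have := qformC v v; lia. Qed.

End Form.

(** * Homomorphisms out of a quantum torus *)

Section Lift.
Variables (I : finType) (B : I -> I -> int) (U : nzRingType).
Variable M : qmon I -> U.
Hypothesis M1 : M (qmon_one I) = 1.
Hypothesis MM : forall a b, M (qmon_mul B a b) = M a * M b.

Definition qlift (f : qtorus B) : U := \sum_(a <- msupp f) M a *~ f@_a.

Lemma qlift_suppE (A : {fset qmon I}) f : (msupp f `<=` A)%fset ->
  qlift f = \sum_(a <- A) M a *~ f@_a.
Proof.
by move=> fA; rewrite /qlift (big_fset_incl _ fA) //= => a _ /mcoeff_outdom ->.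
Qed.

Lemma qlift_zmod : zmod_morphism qlift.
Proof.
move=> f g; pose A := (msupp f `|` msupp g)%fset.
rewrite (@qlift_suppE A (f - g)) ?msuppB_le //.
rewrite (@qlift_suppE A f) ?fsubsetUl // (@qlift_suppE A g) ?fsubsetUr //.
by rewrite -sumrB; apply: eq_bigr => a _; rewrite mcoeffB mulrzBr.
Qed.

HB.instance Definition _ := GRing.isZmodMorphism.Build _ _ qlift qlift_zmod.

Lemma qlift_mono x a : qlift (qmono B x a) = M a *~ x.
Proof.
by rewrite (@qlift_suppE [fset a]%fset) ?qmono_supp // big_seq_fset1 qmonoE.
Qed.

Lemma qlift_monoid : monoid_morphism qlift.
Proof.
split=> [|f g]; first by rewrite /GRing.one /= /qtorus_one qlift_mono M1.
rewrite -[f * g]/(qtorus_mul f g) qtorus_mulE !raddf_sum mulr_suml.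
apply: eq_bigr => a _; rewrite !raddf_sum mulr_sumr; apply: eq_bigr => b _ /=.
by rewrite qlift_mono MM mulrzAl mulrzAr -mulrzA mulrC.
Qed.

HB.instance Definition _ := GRing.isMonoidMorphism.Build _ _ qlift qlift_monoid.

End Lift.

Lemma qmonoMz (I : finType) (B : I -> I -> int) x a :
  qmono B x a = qmono B 1 a *~ x.
Proof.
rewrite qmono.unlock; apply/malgP => b; rewrite raddfMz /= !mcoeffU.
by case: eqP => _; rewrite ?mulr1n ?mulr0n ?intz ?mul0rz.
Qed.

Lemma qtorus_additive_eq (I : finType) (B : I -> I -> int) (U : zmodType)
    (f g : {additive qtorus B -> U}) :
  (forall a, f (qmono B 1 a) = g (qmono B 1 a)) -> f =1 g.
Proof.
move=> fg x; rewrite (qtorusE x) !raddf_sum; apply: eq_bigr => a _ /=.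
by rewrite qmonoMz !raddfMz fg.
Qed.


(** * Homomorphisms out of a fraction field *)

Section Extension.
Variables (T : nzRingType) (K : fraction_field T).

Lemma frac_inj_unit b : b != 0 -> frac_inj K b \is a GRing.unit.
Proof.
by move=> b0; rewrite frac_unit // -(rmorph0 (frac_inj K)) (inj_eq (@frac_injP _ K)).
Qed.

Lemma frac_mul_neq0 (b c : T) : b != 0 -> c != 0 -> b * c != 0.
Proof.
move=> b0 c0; apply/eqP => bc0; have : frac_inj K (b * c) \is a GRing.unit.
  by rewrite rmorphM unitrMr ?frac_inj_unit.
by rewrite bc0 rmorph0 unitr0.
Qed.

(** The right Ore condition holds since the left fraction b^-1 c is also a
    right fraction, like every element of the fraction field. *)
Lemma frac_ore (b c : T) : b != 0 ->
  exists e f, [/\ f != 0, b * e = c * f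
    & (frac_inj K b)^-1 * frac_inj K c = frac_inj K e / frac_inj K f].
Proof.
move=> b0; have [[e f] /= [f0 ef]] := fracP ((frac_inj K b)^-1 * frac_inj K c).
exists e, f; split=> //; apply: (@frac_injP _ K); rewrite !rmorphM.
by rewrite -[frac_inj K e](divrK (frac_inj_unit f0)) -ef mulrA mulVKr ?frac_inj_unit.
Qed.

Lemma frac_common (x y : K) : exists a b c,
  [/\ c != 0, x = frac_inj K a / frac_inj K c & y = frac_inj K b / frac_inj K c].
Proof.
have [[a b] /= [b0 ->]] := fracP x; have [[c d] /= [d0 ->]] := fracP y.
have [e [f [f0 ef _]]] := frac_ore d b0.
have df0 : d * f != 0 by exact: frac_mul_neq0.
have e0 : e != 0 by apply: contra_neq df0 => e0; rewrite -ef e0 mulr0.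
exists (a * e), (c * f), (d * f); split=> //.
  by rewrite -ef !rmorphM invrM ?frac_inj_unit // mulrA mulrK ?frac_inj_unit.
by rewrite !rmorphM invrM ?frac_inj_unit // mulrA mulrK ?frac_inj_unit.
Qed.

Section Hom.
Variables (U : unitRingType) (phi : {rmorphism T -> U}).
Hypothesis phiU : forall b, b != 0 -> phi b \is a GRing.unit.

(** The fraction representing x is chosen; [frac_extE] shows that the choice
    does not matter.  With U the converse ring this is also [fstar]. *)
Definition frac_ext (x : K) : U :=
  let ab := sval (cid (fracP x)) in phi ab.1 / phi ab.2.

Lemma frac_extE (a b : T) : b != 0 ->
  frac_ext (frac_inj K a / frac_inj K b) = phi a / phi b.
Proof.
move=> b0; rewrite /frac_ext; case: cid => -[a' b'] /= [b'0 ab].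
have [e [f [f0 ef efE]]] := frac_ore b' b0.
have aE : a * e = a' * f.
  apply: (@frac_injP _ K); rewrite !rmorphM.
  rewrite -[frac_inj K a](divrK (frac_inj_unit b0)) ab -mulrA -rmorphM ef.
  by rewrite rmorphM mulrA divrK ?frac_inj_unit.
have phie : phi e \is a GRing.unit.
  apply: phiU; apply/eqP => e0.
  have : frac_inj K (b' * f) \is a GRing.unit.
    by rewrite rmorphM unitrMr ?frac_inj_unit.
  by rewrite -ef e0 mulr0 rmorph0 unitr0.
apply: (mulIr (phiU b0)); rewrite divrK ?phiU //.
apply: (mulIr phie); rewrite -!rmorphM -mulrA -rmorphM ef aE !rmorphM mulrA.
by rewrite divrK ?phiU.
Qed.

Lemma frac_ext_inj a : frac_ext (frac_inj K a) = phi a.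
Proof.
have := frac_extE a (oner_neq0 T).
by rewrite !rmorph1 !divr1.
Qed.

Lemma frac_ext_zmod : zmod_morphism frac_ext.
Proof.
move=> x y; have [a [b [c [c0 -> ->]]]] := frac_common x y.
by rewrite -mulrBl -rmorphB !frac_extE // rmorphB mulrBl.
Qed.

Lemma frac_ext_monoid : monoid_morphism frac_ext.
Proof.
split=> [|x y]; first by rewrite -(rmorph1 (frac_inj K)) frac_ext_inj rmorph1.
have [[a b] /= [b0 ->]] := fracP x; have [[c d] /= [d0 ->]] := fracP y.
have [e [f [f0 ef efE]]] := frac_ore c b0.
have df0 : d * f != 0 by exact: frac_mul_neq0.
have -> : frac_inj K a / frac_inj K b * (frac_inj K c / frac_inj K d)
   = frac_inj K (a * e) / frac_inj K (d * f).
  rewrite -mulrA [_^-1 * (_ * _)]mulrA efE !rmorphM invrM ?frac_inj_unit //.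
  by rewrite !mulrA.
rewrite !frac_extE // !rmorphM invrM ?phiU // -!mulrA; congr (_ * _).
rewrite !mulrA; congr (_ / _).
apply: (mulrI (phiU b0)); rewrite mulVKr ?phiU // mulrA -rmorphM ef rmorphM.
by rewrite mulrK ?phiU.
Qed.

HB.instance Definition _ :=
  GRing.isZmodMorphism.Build _ _ frac_ext frac_ext_zmod.
HB.instance Definition _ :=
  GRing.isMonoidMorphism.Build _ _ frac_ext frac_ext_monoid.

End Hom.

Lemma frac_hom_eq (U : unitRingType) (f g : {rmorphism K -> U}) :
  (forall a, f (frac_inj K a) = g (frac_inj K a)) -> f =1 g.
Proof.
move=> fg x; have [[a b] /= [b0 ->]] := fracP x.
by rewrite !rmorphM !rmorphV ?frac_inj_unit //= !fg.
Qed.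

End Extension.

Arguments frac_ext_inj {T} K {U phi}.
Arguments frac_ext_zmod {T} K {U phi}.
Arguments frac_ext_monoid {T} K {U phi}.

(** * The quantum torus in its fraction field *)

Section FractionTorus.
Variables (I : finType) (B : I -> I -> int).
Variable K : fraction_field (qtorus B).
Local Notation t := (fpow K).

Definition mon (v : {ffun I -> int}) : K := frac_inj K (qmono B 1 (0, v)).

Lemma qmonoM (x y : int) a b :
  qmono B x a * qmono B y b = qmono B (x * y) (qmon_mul B a b).
Proof. exact: qtorus_mulU. Qed.

Lemma frac_inj_qmono m v : frac_inj K (qmono B 1 (m, v)) = t m * mon v.
Proof.
by rewrite -rmorphM /= qmonoM mulr1 /qmon_mul /= qform0l !addr0 add0r.
Qed.

Lemma fgenE i : fgen K i = mon (basis_vec i).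
Proof. by []. Qed.

Lemma mon0 : mon 0 = 1.
Proof. exact: rmorph1. Qed.

Lemma fpow0 : t 0 = 1.
Proof. exact: rmorph1. Qed.

Lemma fpowD m n : t (m + n) = t m * t n.
Proof.
by rewrite -rmorphM /= qmonoM mulr1 /qmon_mul /= qform0l !addr0.
Qed.

Lemma monM v w : mon v * mon w = t (qform B v w) * mon (v + w).
Proof. by rewrite -rmorphM /= qmonoM mulr1 -frac_inj_qmono /qmon_mul /= !add0r. Qed.

Lemma fpowC m x : GRing.comm (t m) x.
Proof.
have C a : t m * frac_inj K a = frac_inj K a * t m.
  rewrite -!rmorphM; congr (frac_inj K _).
  rewrite (qtorusE a) mulr_sumr mulr_suml; apply: eq_bigr => -[n v] _.
  by rewrite !qmonoM mul1r mulr1 /qmon_mul /= qform0l qform0r !addr0 add0r addrC.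
have [[a b] /= [b0 ->]] := fracP x.
by rewrite /GRing.comm mulrA C -!mulrA (commrV (C b)).
Qed.

Hypothesis skew : forall i j, B i j = - B j i.

Lemma mon_comm v w : qform B v w = 0 -> GRing.comm (mon v) (mon w).
Proof.
by move=> vw; rewrite /GRing.comm !monM (qformC skew w) vw oppr0 fpow0 !mul1r addrC.
Qed.

Lemma mon_unit v : mon v \is a GRing.unit.
Proof.
by apply/unitrP; exists (mon (- v)); rewrite !monM addNr subrr mon0
  qformNr qformNl qformvv // oppr0 fpow0 mulr1.
Qed.

Lemma monN v : mon (- v) = (mon v)^-1.
Proof.
apply: (mulrI (mon_unit v)); rewrite divrr ?mon_unit // monM subrr mon0.
by rewrite qformNr qformvv // oppr0 fpow0 mulr1.
Qed.

Lemma monD v w : mon (v + w) = t (- qform B v w) * (mon v * mon w).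
Proof. by rewrite monM mulrA -fpowD addNr fpow0 mul1r. Qed.

Lemma monC v w : mon v * mon w = t (2 * qform B v w) * mon w * mon v.
Proof.
rewrite -mulrA (monM w) monM mulrA -fpowD [w + v]addrC (qformC skew w).
by congr (t _ * _); ring.
Qed.

Lemma torus_hom_eq (U : unitRingType) (f g : {rmorphism K -> U}) :
  (forall m, f (t m) = g (t m)) -> (forall i, f (fgen K i) = g (fgen K i)) ->
  f =1 g.
Proof.
move=> fgt fgX; have fgM v : f (mon v) = g (mon v).
  elim/lattice_ind: v => [u v fu fv| i |]; last by rewrite mon0 !rmorph1.
    by rewrite monD monN !rmorphM !rmorphV ?mon_unit //= fgt fu fv.
  exact: fgX.
apply: frac_hom_eq => a.
apply: (qtorus_additive_eq (f := f \o frac_inj K) (g := g \o frac_inj K)).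
by move=> [m v] /=; rewrite frac_inj_qmono !rmorphM fgt fgM.
Qed.

(** The antiautomorphism is handled as a homomorphism to the converse ring, so
    that the extension results apply to it and to its composites. *)
Definition star_morph (a : qtorus B) : K^c := frac_inj K (qstar a).

Lemma star_morph_zmod : zmod_morphism star_morph.
Proof.
move=> a b; have N c : qstar (- c) = - qstar c.
  by apply: (addrI (qstar c)); rewrite -qstarD !subrr qstar0.
by rewrite /star_morph qstarD N rmorphB.
Qed.

Lemma star_morph_monoid : monoid_morphism star_morph.
Proof.
split=> [|a b]; last by rewrite /star_morph qstarM // rmorphM.
by rewrite /star_morph [1]/(qtorus_one B) /qtorus_one qstarU rmorph1.
Qed.

HB.instance Definition _ :=
  GRing.isZmodMorphism.Build _ _ star_morph star_morph_zmod.
HB.instance Definition _ :=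
  GRing.isMonoidMorphism.Build _ _ star_morph star_morph_monoid.

Lemma star_morph_unit b : b != 0 -> star_morph b \is a GRing.unit.
Proof.
move=> b0; apply: (@frac_inj_unit _ K); apply: contra_neq b0 => b0.
by rewrite -[b]qstarK b0 qstar0.
Qed.

Definition fstar_morph : K -> K^c := frac_ext star_morph.

Lemma fstar_inj a : fstar (frac_inj K a) = frac_inj K (qstar a).
Proof. exact: (frac_ext_inj K star_morph_unit). Qed.

Lemma fstar_zmod : zmod_morphism (fstar_morph).
Proof. exact: (frac_ext_zmod K star_morph_unit). Qed.

Lemma fstar_monoid : monoid_morphism (fstar_morph).
Proof. exact: (frac_ext_monoid K star_morph_unit). Qed.

Lemma fstarB (x y : K) : fstar (x - y) = fstar x - fstar y.
Proof. have h := fstar_zmod; exact: (h x y). Qed.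

Lemma fstar0 : fstar (0 : K) = 0.
Proof. by have := fstarB 0 0; rewrite !subrr. Qed.

Lemma fstarN (x : K) : fstar (- x) = - fstar x.
Proof. by rewrite -sub0r fstarB fstar0 sub0r. Qed.

Lemma fstarD (x y : K) : fstar (x + y) = fstar x + fstar y.
Proof. by rewrite -[y]opprK fstarB [in RHS]fstarN. Qed.

Lemma fstar1 : fstar (1 : K) = 1.
Proof. by have [h _] := fstar_monoid; exact: h. Qed.

Lemma fstarM (x y : K) : fstar (x * y) = fstar y * fstar x.
Proof. by have [_ h] := fstar_monoid; exact: (h x y). Qed.

Lemma fstar_unit (x : K) : x \is a GRing.unit -> fstar x \is a GRing.unit.
Proof.
move=> Ux; apply/unitrP; exists (fstar x^-1).
by rewrite -!fstarM divrr ?mulVr // fstar1.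
Qed.

Lemma fstarV (x : K) : x \is a GRing.unit -> fstar x^-1 = (fstar x)^-1.
Proof.
move=> Ux; apply: (mulrI (fstar_unit Ux)).
by rewrite -fstarM mulVr // fstar1 divrr // fstar_unit.
Qed.

Lemma fstar_pow m : fstar (t m) = t (- m).
Proof. by rewrite fstar_inj qstarU. Qed.

Lemma fstar_mon v : fstar (mon v) = mon v.
Proof. by rewrite fstar_inj qstarU oppr0. Qed.

End FractionTorus.

Arguments fstarB {I B K} skew.
Arguments fstarD {I B K} skew.
Arguments fstar1 {I B K} skew.
Arguments fstarM {I B K} skew.
Arguments fstarV {I B K} skew.
Arguments fstar_pow {I B K} skew.
Arguments fstar_mon {I B K} skew.
Arguments mon_unit {I B} K skew.
Arguments monN {I B} K skew.
Arguments monC {I B} K skew.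
Arguments fpowC {I B} K m x.
Arguments torus_hom_eq {I B K} skew {U}.

Section Positive.
Variables (I : finType) (B : I -> I -> int) (K : fraction_field (qtorus B)).

(** Sending every t^m X_v to 1 is additive, though not multiplicative, and takes
    a positive value on such a sum. *)
Lemma sum_mon_neq0 (J : eqType) (r : seq J) (m : J -> int)
    (v : J -> {ffun I -> int}) :
  r != [::] -> \sum_(j <- r) fpow K (m j) * mon K (v j) != 0.
Proof.
move=> r0; under eq_bigr => j _ do rewrite -frac_inj_qmono.
rewrite -raddf_sum /= -(rmorph0 (frac_inj K)) (inj_eq (@frac_injP _ K)).
apply/eqP => /(congr1 (@qlift _ B int (fun=> 1))).
rewrite raddf0 raddf_sum /=; under eq_bigr => j _ do rewrite qlift_mono.
by rewrite big_const_seq count_predT iter_addr_0 natz; case: r r0.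
Qed.

End Positive.

(** * Products of an integer number of factors *)

Section Ladder.
Variables (R : unitRingType).
Implicit Types (f g : int -> R) (m n : int).

(** The product f 0 ... f (n - 1); for negative n it is continued so that
    [ladderSr] holds for all n, that is, as the inverse of
    f n ... f (- 1). *)
Definition ladder f n : R :=
  match n with
  | Posz k => \prod_(0 <= a < k) f a%:Z
  | Negz k => (\prod_(0 <= a < k.+1) f (a%:Z - k.+1%:Z))^-1
  end.

Lemma ladder0 f : ladder f 0 = 1.
Proof. by rewrite -[0]/(Posz 0) /ladder big_geq. Qed.

Lemma ladder1 f : ladder f 1 = f 0.
Proof. by rewrite -[1]/(Posz 1) /ladder big_nat1. Qed.

Lemma ladderN1 f : ladder f (-1) = (f (-1))^-1.
Proof. by rewrite -[X in ladder _ X]/(Negz 0) /ladder big_nat1. Qed.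

Lemma eq_ladder f g : f =1 g -> ladder f =1 ladder g.
Proof.
by move=> fg [k|k] /=; [|congr _^-1]; apply: eq_bigr => a _; rewrite fg.
Qed.

Lemma ladderSr f n : (forall a, f a \is a GRing.unit) ->
  ladder f (n + 1) = ladder f n * f n.
Proof.
move=> fU; case: n => k; first by rewrite -PoszD addn1 /ladder big_nat_recr.
rewrite NegzE; case: k => [|k].
  by rewrite addNr ladder0 -NegzE /ladder big_nat1 sub0r NegzE mulVr.
have -> : - k.+2%:Z + 1 = - k.+1%:Z by lia.
rewrite -!NegzE /ladder [in RHS]big_ltn // sub0r invrM ?unitr_prod //.
rewrite NegzE divrK //; congr _^-1; rewrite big_add1.
by apply: eq_bigr => a _; congr f; lia.
Qed.

Lemma int_step_ind (P : int -> Prop) : P 0 ->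
  (forall n, P n -> P (n + 1)) -> (forall n, P (n + 1) -> P n) -> forall n, P n.
Proof.
move=> P0 Pu Pd; elim/int_rec=> // n Pn.
  by rewrite -addn1 PoszD; apply: Pu.
by apply: Pd; have -> : - n.+1%:Z + 1 = - n%:Z by lia.
Qed.

Lemma ladder_unit f n : (forall a, f a \is a GRing.unit) ->
  ladder f n \is a GRing.unit.
Proof.
move=> fU; elim/int_step_ind: n => [|n|n]; first by rewrite ladder0 unitr1.
  by rewrite ladderSr // => h; rewrite unitrMl.
by rewrite ladderSr // unitrMl.
Qed.

(** This cocycle rule is what makes conjugation by a dilogarithm
    multiplicative. *)
Lemma ladderD f m n : (forall a, f a \is a GRing.unit) ->
  ladder f (m + n) = ladder f m * ladder (fun a => f (m + a)) n.
Proof.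
move=> fU; have gU a : f (m + a) \is a GRing.unit by [].
elim/int_step_ind: n => [|n IH|n]; first by rewrite addr0 ladder0 mulr1.
  by rewrite addrA (ladderSr (m + n) fU) IH (ladderSr n gU) mulrA.
rewrite addrA (ladderSr (m + n) fU) (ladderSr n gU) mulrA; exact: mulIr.
Qed.

Lemma ladder_conj f g x n : (forall a, f a \is a GRing.unit) ->
  (forall a, g a \is a GRing.unit) ->
  (forall a, f a * x = x * g a) -> ladder f n * x = x * ladder g n.
Proof.
move=> fU gU fg; elim/int_step_ind: n => [|n IH|n].
- by rewrite !ladder0 mul1r mulr1.
- by rewrite !ladderSr // -mulrA fg mulrA IH mulrA.
rewrite !ladderSr // -mulrA fg !mulrA; exact: mulIr.
Qed.

Lemma ladder_comm f x n : (forall a, f a \is a GRing.unit) ->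
  (forall a, GRing.comm (f a) x) -> GRing.comm (ladder f n) x.
Proof. by move=> fU fx; apply: ladder_conj. Qed.

End Ladder.

Lemma rmorph_ladder (R S : unitRingType) (h : {rmorphism R -> S}) (f : int -> R) n :
  (forall a, f a \is a GRing.unit) ->
  h (ladder f n) = ladder (fun a => h (f a)) n.
Proof.
move=> fU; have hU a : h (f a) \is a GRing.unit by rewrite rmorph_unit.
elim/int_step_ind: n => [|n IH|n]; first by rewrite !ladder0 rmorph1.
  by rewrite !ladderSr // rmorphM IH.
by rewrite !ladderSr // rmorphM; apply: mulIr.
Qed.
Arguments ladder : simpl never.

(** * Positive maps from projective representations of the lattice *)

Definition rmorphism_of (R S : nzRingType) (f : R -> S)
    (fB : zmod_morphism f) (fM : monoid_morphism f) : {rmorphism R -> S} :=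
  HB.pack f (GRing.isZmodMorphism.Build R S f fB)
            (GRing.isMonoidMorphism.Build R S f fM).

Definition qpos_rmorphism (S T : qpos_ob) (f : qpos_hom S T) :
  {rmorphism S -> T} := rmorphism_of (psm_zmod (qmapP f)) (psm_monoid (qmapP f)).

Lemma qpos_rmorphismE S T (f : qpos_hom S T) x : f x = qpos_rmorphism f x.
Proof. by []. Qed.

Lemma qpos_hom_fgen_eq S T (f g : qpos_hom S T) :
  (forall i, f (fgen S i) = g (fgen S i)) -> f = g.
Proof.
move=> fg; apply/qpos_hom_eq/funext => x; rewrite !qpos_rmorphismE.
apply: (torus_hom_eq (@qB_skew S)) => [m|i]; rewrite -!qpos_rmorphismE //.
by rewrite !psm_pow //; apply: qmapP.
Qed.

Section Representation.
Variables (S T : qpos_ob) (M : {ffun qindex S -> int} -> T).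
Local Notation t := (fpow T).
Hypothesis M0 : M 0 = 1.
Hypothesis MM : forall v w, M v * M w = t (qform (@qB S) v w) * M (v + w).

(** A projective representation M of the lattice, whose cocycle is given by
    the form of S, extends to the monomials t^m X_v by t^m M v, and then
    linearly to the torus. *)
Definition rep_mon (a : qmon (qindex S)) : T := t a.1 * M a.2.

Lemma rep_mon1 : rep_mon (qmon_one _) = 1.
Proof. by rewrite /rep_mon fpow0 M0 mulr1. Qed.

Lemma rep_monM a b : rep_mon (qmon_mul (@qB S) a b) = rep_mon a * rep_mon b.
Proof.
rewrite /rep_mon /= !fpowD -!mulrA -MM; congr (_ * _).
by rewrite !mulrA; congr (_ * _); apply: fpowC.
Qed.

Definition rep_morph : {rmorphism qtorus (@qB S) -> T} :=
  rmorphism_of (@qlift_zmod _ (@qB S) _ rep_mon)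
               (qlift_monoid rep_mon1 rep_monM).

Lemma rep_morphE m v : rep_morph (qmono _ 1 (m, v)) = t m * M v.
Proof. exact: qlift_mono. Qed.

Hypothesis Minj : forall a, rep_morph a = 0 -> a = 0.
Hypothesis Mstar : forall v, fstar (M v) = M v.
Hypothesis Mpos : forall i, subtraction_free (M (basis_vec i)).

Lemma rep_morph_unit a : a != 0 -> rep_morph a \is a GRing.unit.
Proof. by move=> a0; apply: frac_unit; apply: contra_neq a0; apply: Minj. Qed.

Let F : {rmorphism S -> T} :=
  rmorphism_of (frac_ext_zmod S rep_morph_unit)
               (frac_ext_monoid S rep_morph_unit).

Let F_inj a : F (frac_inj S a) = rep_morph a.
Proof. exact: (frac_ext_inj S rep_morph_unit). Qed.

Let F_mon v : F (mon S v) = M v.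
Proof. by rewrite F_inj rep_morphE fpow0 mul1r. Qed.

Let F_pow m : F (fpow S m) = fpow T m.
Proof. by rewrite F_inj rep_morphE M0 mulr1. Qed.

Let F_star x : F (fstar x) = fstar (F x).
Proof.
pose G x : T^c := F (fstar x); pose H x : T^c := fstar (F x).
have GB : zmod_morphism G.
  by move=> y z; rewrite /G (fstarB (@qB_skew S)) rmorphB.
have GM : monoid_morphism G.
  split=> [|y z]; first by rewrite /G (fstar1 (@qB_skew S)) rmorph1.
  by rewrite /G (fstarM (@qB_skew S)) rmorphM.
have HB : zmod_morphism H.
  by move=> y z; rewrite /H rmorphB (fstarB (@qB_skew T)).
have HM : monoid_morphism H.
  split=> [|y z]; first by rewrite /H rmorph1 (fstar1 (@qB_skew T)).
  by rewrite /H rmorphM (fstarM (@qB_skew T)).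
apply: (torus_hom_eq (@qB_skew S) (rmorphism_of GB GM) (rmorphism_of HB HM)).
  move=> m; rewrite /= /G /H (fstar_pow (@qB_skew S)) !F_pow.
  by rewrite (fstar_pow (@qB_skew T)).
move=> i; rewrite /= /G /H !fgenE (fstar_mon (@qB_skew S)) !F_mon.
by rewrite Mstar.
Qed.

Lemma qpos_hom_of_rep : exists f : qpos_hom S T, forall v, f (mon S v) = M v.
Proof.
have P : is_positive_star_map F.
  split; [exact: rmorphB | exact: (rmorphism_monoidP F) | exact: F_pow
         | exact: F_star |].
  by move=> i; rewrite fgenE F_mon.
by exists (QPosHom P).
Qed.

End Representation.

(** * The lattice map of a mutation *)

Definition integral_seed (N : nat) (I : finType) (s : seed I) : Prop :=
  (forall i j, N%:R * eps_hat s i j \is a Num.int) /\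
  (forall i, (seed_d s i %| N)%N).

Section SeedForm.
Variables (N : nat) (I : finType) (s : seed I).
Hypothesis sN : integral_seed N s.

Lemma seed_formE i j : (seed_form N s i j)%:~R = N%:R * eps_hat s i j :> rat.
Proof. by rewrite /seed_form numqK // sN.1. Qed.

Lemma seed_d_neq0 i : (seed_d s i)%:R != 0 :> rat.
Proof. by rewrite pnatr_eq0 -lt0n d_gt0. Qed.

Lemma eps_diag i : eps s i i = 0.
Proof.
have := eps_skew s i i => /eqP; rewrite -addr_eq0 -mulr2n mulrn_eq0 /=.
by rewrite mulf_eq0 invr_eq0 (negPf (seed_d_neq0 i)) orbF => /eqP.
Qed.

End SeedForm.

Definition exch (I : finType) (s : seed I) (i k : I) : int := numq (eps s i k).

Definition qk_exp (N : nat) (I : finType) (s : seed I) (k : I) : int :=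
  (N %/ seed_d s k)%N.

Lemma rmorph_max0 (n : int) : (Num.max 0 n)%:~R = Num.max 0 n%:~R :> rat.
Proof. by rewrite !maxEle ler0z; case: ifP. Qed.

Section LatticeMutation.
Variables (N : nat) (I : finType) (s : seed I) (k : I).
Local Notation e := (exch s).
Local Notation X_ := (@basis_vec I).

(** [d_k (v, e_k)] for the form of the lattice; it is an integer when k is not
    frozen. *)
Definition pairing (v : {ffun I -> int}) : int := \sum_i v i * e i k.

(** The linear map e_k |-> - e_k, e_i |-> e_i + max(0, - eps_ik) e_k.  With
    this sign, rather than max(0, eps_ik), e_j stays in place for eps_ji > 0,
    which keeps the rank two computations small. *)
Definition lat_mut (v : {ffun I -> int}) : {ffun I -> int} :=
  [ffun i => if i == k then - v k + \sum_j v j * Num.max 0 (- e j k) else v i].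

Lemma exchkk : e k k = 0.
Proof. by rewrite /exch eps_diag. Qed.

Lemma pairingB u v : pairing (u - v) = pairing u - pairing v.
Proof. by rewrite -sumrB; apply: eq_bigr => i _; rewrite !ffunE mulrBl. Qed.

Lemma pairingD u v : pairing (u + v) = pairing u + pairing v.
Proof. by rewrite -big_split; apply: eq_bigr => i _; rewrite !ffunE mulrDl. Qed.

Lemma pairingN v : pairing (- v) = - pairing v.
Proof. by rewrite -sumrN; apply: eq_bigr => i _; rewrite !ffunE mulNr. Qed.

Lemma pairing_basis i : pairing (X_ i) = e i k.
Proof.
rewrite /pairing (bigD1 i) //= big1 ?addr0 ?ffunE ?eqxx ?mul1r // => j ji.
by rewrite ffunE eq_sym (negPf ji) mul0r.
Qed.

Lemma pairing_basisMz i d : pairing (X_ i *~ d) = d * e i k.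
Proof.
rewrite -pairing_basis /pairing mulr_sumr; apply: eq_bigr => l _.
by rewrite ffunMzE mulrzz; ring.
Qed.

Lemma lat_mutB u v : lat_mut (u - v) = lat_mut u - lat_mut v.
Proof.
apply/ffunP => i; rewrite !ffunE; case: eqP => // _.
have -> : \sum_j (u - v) j * Num.max 0 (- e j k)
  = \sum_j u j * Num.max 0 (- e j k) - \sum_j v j * Num.max 0 (- e j k).
  by rewrite -sumrB; apply: eq_bigr => j _; rewrite !ffunE mulrBl.
by ring.
Qed.

Lemma lat_mut0 : lat_mut 0 = 0.
Proof. by have := lat_mutB 0 0; rewrite !subrr. Qed.

Lemma lat_mutN v : lat_mut (- v) = - lat_mut v.
Proof. by rewrite -sub0r lat_mutB lat_mut0 sub0r. Qed.

Lemma lat_mutD u v : lat_mut (u + v) = lat_mut u + lat_mut v.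
Proof. by rewrite -[v in LHS]opprK lat_mutB lat_mutN opprK. Qed.

Lemma lat_mutK : involutive lat_mut.
Proof.
move=> v; apply/ffunP => i; rewrite !ffunE eqxx; case: eqP => [->|//].
have -> : \sum_j lat_mut v j * Num.max 0 (- e j k)
    = \sum_j v j * Num.max 0 (- e j k).
  apply: eq_bigr => j _; rewrite ffunE; case: eqP => // ->.
  by rewrite exchkk oppr0 maxxx !mulr0.
by ring.
Qed.

Lemma lat_mut_basis i :
  lat_mut (X_ i) = if i == k then - X_ k else X_ i + X_ k *~ Num.max 0 (- e i k).
Proof.
apply/ffunP => j; rewrite !ffunE.
have -> : \sum_l X_ i l * Num.max 0 (- e l k) = Num.max 0 (- e i k).
  rewrite (bigD1 i) //= big1 ?addr0 ?ffunE ?eqxx ?mul1r // => l li.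
  by rewrite ffunE eq_sym (negPf li) mul0r.
have [->|jk] := eqVneq j k; have [ik|ik] := eqVneq i k.
- by rewrite ik !ffunE eqxx exchkk oppr0 maxxx addr0.
- by rewrite !ffunE ffunMzE !ffunE eqxx (negPf ik) oppr0 !add0r intz.
- by rewrite ik !ffunE eq_sym (negPf jk).
- by rewrite !ffunE ffunMzE !ffunE [k == j]eq_sym (negPf jk) mul0rz addr0.
Qed.

Lemma pairing_lat_mut v : pairing (lat_mut v) = pairing v.
Proof.
apply: eq_bigr => i _; rewrite ffunE; case: eqP => // ->.
by rewrite exchkk !mulr0.
Qed.

Hypothesis k_mut : k \notin frozen s.
Hypothesis sN : integral_seed N s.

Lemma exchE i : (e i k)%:~R = eps s i k.
Proof. by rewrite /exch numqK // eps_int // (negPf k_mut) andbF. Qed.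

Local Notation B := (seed_form N s).
Local Notation B' := (seed_form N (mutate k_mut)).
Local Notation m := (qk_exp N s k).

Lemma qk_expE : m%:~R = N%:R / (seed_d s k)%:R :> rat.
Proof.
rewrite /qk_exp; have /dvdnP [c ->] := sN.2 k.
by rewrite mulnK ?d_gt0 // natrM mulfK // seed_d_neq0.
Qed.

Lemma seed_form_mut i : B i k = m * e i k.
Proof.
apply: (@intr_inj rat); rewrite intrM seed_formE // qk_expE exchE /eps_hat.
by rewrite mulrAC mulrA.
Qed.

Lemma qform_pairing v : qform B v (X_ k) = m * pairing v.
Proof.
rewrite qform_basis mulr_sumr; apply: eq_bigr => i _.
by rewrite seed_form_mut mulrCA.
Qed.

Lemma integral_mutate : integral_seed N (mutate k_mut).
Proof.
split=> [i j|i]; last exact: sN.2.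
rewrite /eps_hat /= /mutate_eps; case: ifP => [_|/norP [ki kj]].
  by rewrite mulNr mulrN rpredN; apply: sN.1.
case: ifP => _; first exact: sN.1.
rewrite mulrDl mulrDr rpredD //; first exact: sN.1.
by rewrite -mulrA mulrCA rpredM ?sN.1 // -exchE -intr_norm intr_int.
Qed.

Lemma qformMzl v w n : qform B (v *~ n) w = n * qform B v w.
Proof.
rewrite /qform mulr_sumr; apply: eq_bigr => i _; rewrite mulr_sumr.
by apply: eq_bigr => j _; rewrite ffunMzE mulrzz; ring.
Qed.

Lemma qformMzr v w n : qform B v (w *~ n) = n * qform B v w.
Proof.
rewrite /qform mulr_sumr; apply: eq_bigr => i _; rewrite mulr_sumr.
by apply: eq_bigr => j _; rewrite ffunMzE mulrzz; ring.
Qed.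

(** Both sides are bilinear, and on two basis vectors other than e_k this is
    the mutation rule written as
    eps'_ij = eps_ij + max(0, - eps_ik) eps_kj + eps_ik max(0, eps_kj). *)
Lemma qform_lat_mut v w : qform B' v w = qform B (lat_mut v) (lat_mut w).
Proof.
have Bkk : B k k = 0 by rewrite seed_form_mut exchkk mulr0.
elim/lattice_ind: v => [u v Pu Pv|i|].
- by rewrite qformDl qformNl lat_mutB qformDl qformNl Pu Pv.
- elim/lattice_ind: w => [u v Pu Pv|j|].
  + by rewrite qformDr qformNr lat_mutB qformDr qformNr Pu Pv.
  + rewrite qform_basis2 !lat_mut_basis.
    apply: (@intr_inj rat); rewrite seed_formE; last exact: integral_mutate.
    have [->|ik] := eqVneq i k; have [->|jk] := eqVneq j k.
    * rewrite qformNl qformNr opprK qform_basis2 Bkk /eps_hat /= /mutate_eps eqxx.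
      by rewrite eps_diag oppr0 mul0r mulr0.
    * rewrite qformNl qformDr qformMzr !qform_basis2 Bkk mulr0 addr0.
      rewrite rmorphN /= seed_formE // /eps_hat /= /mutate_eps eqxx /=.
      by rewrite mulNr mulrN.
    * rewrite qformNr qformDl qformMzl !qform_basis2 Bkk mulr0 addr0.
      rewrite rmorphN /= seed_formE // /eps_hat /= /mutate_eps eqxx orbT /=.
      by rewrite mulNr mulrN.
    rewrite !(qformDl, qformDr) !(qformMzl, qformMzr) !qform_basis2 Bkk.
    rewrite !mulr0 !addr0 !rmorphD !rmorphM /= !seed_formE // /eps_hat /=.
    rewrite /mutate_eps eq_sym (negPf ik) eq_sym (negPf jk) /=.
    rewrite !rmorph_max0 !rmorphN /= !exchE.
    have dj := seed_d_neq0 s j; have dk := seed_d_neq0 s k.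
    have jkE : eps s j k = - (eps s k j * (seed_d s k)%:R / (seed_d s j)%:R).
      have := eps_skew s j k => /(congr1 ( *%R^~ (seed_d s k)%:R)).
      by rewrite divfK // => ->; rewrite mulNr mulrAC.
    have -> : Num.max 0 (- eps s j k)
        = Num.max 0 (eps s k j) * ((seed_d s k)%:R / (seed_d s j)%:R).
      have r0 : 0 <= (seed_d s k)%:R / (seed_d s j)%:R :> rat.
        by rewrite divr_ge0 ?ler0n.
      by rewrite jkE opprK -mulrA maxr_pMl // mul0r.
    have key (a b : rat) : (if a * b <= 0 then 0 else `|a| * b)
        = Num.max 0 b * a + Num.max 0 (- a) * b.
      have [a0|a0] := leP 0 a; have [b0|b0] := leP 0 b.
      - rewrite max_l ?oppr_le0 // ger0_norm //.
        by case: leP => ab; nra.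
      - rewrite max_l ?oppr_le0 // ger0_norm //.
        by case: leP => ab; nra.
      - have a1 : 0 <= - a by rewrite oppr_ge0 ltW.
        rewrite (max_r a1) ltr0_norm //.
        by case: leP => ab; nra.
      - have a1 : 0 <= - a by rewrite oppr_ge0 ltW.
        rewrite (max_r a1) ltr0_norm //.
        by case: leP => ab; nra.
    have := key (eps s i k) (eps s k j).
    set x := Num.max 0 _; set y := Num.max 0 _; move=> E.
    have -> : (if eps s i k * eps s k j <= 0 then eps s i j
               else eps s i j + `|eps s i k| * eps s k j)
       = eps s i j + (x * eps s i k + y * eps s k j).
      by rewrite -E; case: ifP; rewrite ?addr0.
    by field; rewrite dj dk.
  + by rewrite lat_mut0 !qform0r.
- by rewrite lat_mut0 !qform0l.
Qed.

End LatticeMutation.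

(** * The mutation homomorphism *)

(** Distinct monomials stay distinct under an injective map of lattices; the
    left inverse g recovers the coefficients. *)
Lemma monomial_map_inj (I J : finType) (B : I -> I -> int) (B' : J -> J -> int)
    (K : fraction_field (qtorus B)) (h : {ffun J -> int} -> {ffun I -> int}) g
    (a : qtorus B') : cancel h g ->
  \sum_(b <- msupp a) (fpow K b.1 * mon K (h b.2)) *~ a@_b = 0 -> a = 0.
Proof.
move=> hK; under eq_bigr => b _ do rewrite -frac_inj_qmono -raddfMz.
rewrite -raddf_sum -(rmorph0 (frac_inj K)) => /frac_injP.
move=> /(congr1 (@qlift _ B _ (fun b => qmono B' 1 (b.1, g b.2)))).
rewrite raddf0 raddf_sum /= => E; rewrite (qtorusE a) -[RHS]E.
apply: eq_bigr => -[m v] _ /=; rewrite raddfMz /= qlift_mono mulr1z /= hK.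
by rewrite -qmonoMz.
Qed.

Section MutationHom.
Variables (N : nat) (I : finType) (s : seed I) (k : I).
Hypothesis k_mut : k \notin frozen s.
Hypothesis sN : integral_seed N s.
Local Notation B := (seed_form N s).
Local Notation s' := (mutate k_mut).
Local Notation B' := (seed_form N s').
Local Notation m := (qk_exp N s k).
Local Notation L := (lat_mut s k).
Local Notation tau := (pairing s k).
Variables (K : fraction_field (qtorus B)) (K' : fraction_field (qtorus B')).
Local Notation t := (fpow K).
Local Notation X := (mon K).
Let skew := seed_form_skew N s.

(** A factor of the dilogarithm of X_k^-1, with its index continued to the
    negative integers. *)
Definition dilog_factor (a : int) : K :=
  1 + t (m * (2 * a + 1)) * X (- basis_vec k).
Local Notation psi := dilog_factor.
Local Notation lad := (ladder psi).

Lemma dilog_factor_unit a : psi a \is a GRing.unit.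
Proof.
apply: frac_unit; have := @sum_mon_neq0 _ _ K _ [:: false; true]
  (fun b => if b then m * (2 * a + 1) else 0)
  (fun b => if b then - basis_vec k else 0) isT.
by rewrite big_cons big_seq1 fpow0 mon0 mulr1.
Qed.
Let psiU := dilog_factor_unit.

Lemma dilog_factor_mon a v : psi a * X v = X v * psi (tau v + a).
Proof.
rewrite mulrDl [RHS]mulrDr mul1r mulr1; congr (_ + _).
rewrite -mulrA (monC K skew (- _) v) [RHS]mulrA -(fpowC K _ (X v)).
rewrite -!mulrA [LHS]mulrA -fpowD; congr (t _ * _).
by rewrite qformNl (qformC skew) opprK (qform_pairing k_mut sN); ring.
Qed.

Lemma dilog_factor_comm a b : GRing.comm (psi a) (psi b).
Proof.
apply: commrD; first exact: commr1.
apply: commrM; first exact/commr_sym/fpowC.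
apply/commr_sym/commrD; first exact: commr1.
by apply: commrM; [exact/commr_sym/fpowC | ].
Qed.

Lemma ladder_mon n v : lad n * X v = X v * ladder (fun a => psi (tau v + a)) n.
Proof. by apply: ladder_conj => // a; apply: dilog_factor_mon. Qed.

(** Conjugation by the inverse of the quantum dilogarithm of X_k^-1, after the
    identification of the two lattices by [lat_mut]. *)
Definition mutation_rep (v : {ffun I -> int}) : K := X (L v) / lad (tau v).

Lemma mutation_rep0 : mutation_rep 0 = 1.
Proof.
rewrite /mutation_rep lat_mut0 mon0 /pairing big1 ?ladder0 ?divr1 // => i _.
by rewrite ffunE mul0r.
Qed.

Lemma mutation_repM v w :
  mutation_rep v * mutation_rep w = t (qform B' v w) * mutation_rep (v + w).
Proof.
have U n : lad n \is a GRing.unit by apply: ladder_unit.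
have U' c n : ladder (fun a => psi (c + a)) n \is a GRing.unit.
  exact: ladder_unit.
have E : (lad (tau v))^-1 * X (L w)
    = X (L w) / ladder (fun a => psi (tau w + a)) (tau v).
  apply: (mulrI (U (tau v))); rewrite mulVKr // mulrA ladder_mon.
  by rewrite pairing_lat_mut mulrK.
rewrite /mutation_rep -mulrA [_^-1 * _]mulrA E !mulrA monM qform_lat_mut //.
rewrite -lat_mutD -!mulrA; congr (_ * (_ * _)).
by rewrite -invrM // -ladderD // pairingD addrC.
Qed.

(** Conjugation by the quantum dilogarithm of X_k^-1, without change of lattice;
    it serves to undo [mutation_rep]. *)
Definition dilog_rep (v : {ffun I -> int}) : K := X v * lad (tau v).

Lemma dilog_rep0 : dilog_rep 0 = 1.
Proof.
rewrite /dilog_rep mon0 /pairing big1 ?ladder0 ?mulr1 // => i _.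
by rewrite ffunE mul0r.
Qed.

Lemma dilog_repM v w :
  dilog_rep v * dilog_rep w = t (qform B v w) * dilog_rep (v + w).
Proof.
rewrite /dilog_rep -mulrA [lad _ * (_ * _)]mulrA ladder_mon !mulrA monM.
rewrite -!mulrA; congr (_ * (_ * _)).
rewrite pairingD [in RHS]addrC ladderD //.
by apply/ladder_comm => // a; apply/commr_sym/ladder_comm => // b; apply: dilog_factor_comm.
Qed.

Let S : qpos_ob := QPosOb (seed_form_skew N s') K'.
Let T : qpos_ob := QPosOb skew K.

Let phi : {rmorphism qtorus B' -> K} :=
  @rep_morph S T mutation_rep mutation_rep0 mutation_repM.
Let dilog_morph : {rmorphism qtorus B -> K} :=
  @rep_morph T T dilog_rep dilog_rep0 dilog_repM.

Let dilog_morphE b v :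
  dilog_morph (qmono B 1 (b, v)) = t b * dilog_rep v.
Proof. exact: (rep_morphE (S := T) (T := T) dilog_rep0 dilog_repM). Qed.

(** [dilog_factor a] as an element of the torus, before taking fractions. *)
Let psiT (a : int) : qtorus B :=
  1 + qmono B 1 (m * (2 * a + 1), - basis_vec k).

Let psiTE a : frac_inj K (psiT a) = psi a.
Proof. by rewrite rmorphD rmorph1 frac_inj_qmono. Qed.

Let dilog_morph_psiT a : dilog_morph (psiT a) = psi a.
Proof.
rewrite rmorphD rmorph1 dilog_morphE /dilog_rep pairingN pairing_basis exchkk.
by rewrite oppr0 ladder0 mulr1.
Qed.

(** For n at least all the pairings that occur in a, the product of the image
    of a by [lad n] has no denominator left: it comes from an element of the
    torus, to which [dilog_morph] applies.  The result is a, read in the other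
    lattice, times [lad n]. *)
Lemma mutation_rep_inj a : phi a = 0 -> a = 0.
Proof.
move=> phia; pose n := (\sum_(b <- msupp a) `|tau b.2|)%N.
have leN b : b \in msupp a -> tau b.2 <= n%:Z.
  move=> ba; apply: le_trans (ler_norm _) _.
  rewrite -abszE lez_nat /n (big_rem b) //=; exact: leq_addr.
pose e (b : qmon I) : qtorus B := qmono B 1 (b.1, L b.2)
   * \prod_(0 <= j < `|n%:Z - tau b.2|) psiT (tau b.2 + j%:Z).
have lad_prod b : b \in msupp a ->
    lad n = lad (tau b.2)
      * \prod_(0 <= j < `|n%:Z - tau b.2|) psi (tau b.2 + j%:Z).
  move=> ba; have {1}-> : n%:Z = tau b.2 + `|n%:Z - tau b.2|%N.
    by rewrite gez0_abs ?subr_ge0 ?leN //; ring.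
  by rewrite ladderD.
have eK b : b \in msupp a ->
    frac_inj K (e b) = t b.1 * mutation_rep b.2 * lad n.
  move=> ba; rewrite /e rmorphM /= frac_inj_qmono rmorph_prod /=.
  rewrite (eq_bigr _ (fun j _ => psiTE (tau b.2 + j%:Z))) (lad_prod b ba).
  by rewrite /mutation_rep -!mulrA mulKr // ladder_unit.
have eD b : b \in msupp a ->
    dilog_morph (e b) = t b.1 * X (L b.2) * lad n.
  move=> ba; rewrite /e rmorphM dilog_morphE rmorph_prod /=.
  rewrite (eq_bigr _ (fun j _ => dilog_morph_psiT (tau b.2 + j%:Z))).
  by rewrite (lad_prod b ba) /dilog_rep pairing_lat_mut -!mulrA.
have sum0 : \sum_(b <- msupp a) e b *~ a@_b = 0.
  apply: (@frac_injP _ K); rewrite rmorph0 raddf_sum /=.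
  transitivity (phi a * lad n); last by rewrite phia mul0r.
  have -> : phi a = \sum_(b <- msupp a) (t b.1 * mutation_rep b.2) *~ a@_b by [].
  rewrite mulr_suml.
  rewrite !big_seq; apply: eq_bigr => b ba.
  by rewrite raddfMz /= eK // mulrzAl.
have /(congr1 dilog_morph) := sum0; rewrite rmorph0 raddf_sum /= => E.
apply: (monomial_map_inj (K := K) (lat_mutK s k)).
apply: (mulIr (ladder_unit n psiU)); rewrite mul0r -[RHS]E mulr_suml.
rewrite !big_seq; apply: eq_bigr => b ba.
by rewrite raddfMz /= eD // mulrzAl.
Qed.

Lemma dilog_factor_star a : fstar (psi a) = psi (- (a + 1)).
Proof.
rewrite (fstarD skew) (fstar1 skew) (fstarM skew) (fstar_pow skew).
rewrite (fstar_mon skew); congr (_ + _).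
by rewrite -fpowC; congr (t _ * _); ring.
Qed.

(** The star exchanges the factors of indices a and - a - 1 and reverses their
    order. *)
Lemma ladder_star n : fstar (lad n) = (lad (- n))^-1.
Proof.
have fU j : fstar (psi j) \is a GRing.unit by apply/(fstar_unit skew)/psiU.
suff E : fstar (lad n) * lad (- n) = 1.
  have U := ladder_unit (- n) psiU.
  by apply: (mulIr U); rewrite E mulVr.
have swap x p : p \is a GRing.unit -> (x * p = 1) <-> (p * x = 1).
  move=> U; split=> E; first by apply: (mulIr U); rewrite -mulrA E mulr1 mul1r.
  by apply: (mulrI U); rewrite mulrA E mulr1 mul1r.
have step c : fstar (lad (c + 1)) * lad (- (c + 1)) = 1
    <-> fstar (lad c) * lad (- c) = 1.
  have -> : lad (- c) = lad (- (c + 1)) * fstar (psi c).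
    by rewrite dilog_factor_star -ladderSr //; congr ladder; ring.
  rewrite ladderSr // (fstarM skew) -mulrA [X in _ <-> X = _]mulrA.
  by apply: iff_sym; apply: swap (fU c).
elim/int_step_ind: n => [|n /step //|n /step //].
by rewrite oppr0 ladder0 (fstar1 skew) mulr1.
Qed.

Lemma mutation_rep_star v : fstar (mutation_rep v) = mutation_rep v.
Proof.
have U n : lad n \is a GRing.unit by apply: ladder_unit.
rewrite /mutation_rep (fstarM skew) (fstarV skew) // (fstar_mon skew).
rewrite ladder_star invrK ladder_mon pairing_lat_mut; congr (_ * _).
apply: (mulrI (U (tau v))); rewrite divrr // -ladderD //.
by rewrite subrr ladder0.
Qed.

(** Pulling the monomial q_k^-(2a-1) X_k^-1 out of the factor of index - a
    leaves 1 + q_k^(2a-1) X_k; the exponents of q_k add up to - n^2. *)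
Lemma ladder_opp n :
  (lad (- n%:Z))^-1 = t (- (m * (n * n)%N)) * X (- (basis_vec k *+ n))
    * \prod_(1 <= a < n.+1) (1 + t (m * (2 * a - 1)%N) * fgen K k).
Proof.
elim: n => [|n IH].
  by rewrite ladder0 invr1 big_geq // mulr0 oppr0 fpow0 mulr0n oppr0 mon0 !mulr1.
have -> : (lad (- n.+1%:Z))^-1 = psi (- n.+1%:Z) / lad (- n%:Z).
  have -> : - n%:Z = - n.+1%:Z + 1 by lia.
  by rewrite ladderSr // invrM ?ladder_unit // mulVKr.
have -> : psi (- n.+1%:Z) = t (- (m * (2 * n + 1)%N)) * X (- basis_vec k)
    * (1 + t (m * (2 * n.+1 - 1)%N) * fgen K k).
  rewrite mulrDr mulr1 addrC; congr (_ + _); last first.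
    by congr (t _ * _); lia.
  rewrite -mulrA [X _ * (t _ * _)]mulrA -(fpowC K _ (X _)) !mulrA -fpowD -mulrA.
  by rewrite fgenE (monN K skew) mulVr ?mon_unit // mulr1 -fpow0; congr t; lia.
rewrite IH [in RHS]big_nat_recr //.
set F := 1 + t (m * (2 * n.+1 - 1)%N) * _; 
set P := \prod_(1 <= a < n.+1) (1 + t (m * (2 * a - 1)%N) * fgen K k).
have FC y : GRing.comm (fgen K k) y -> GRing.comm F y.
  move=> Xy; apply/commr_sym/commrD; first exact: commr1.
  by apply: commrM; [exact/commr_sym/fpowC | exact/commr_sym].
have q0 l : qform B (basis_vec k *~ l) (- (basis_vec k *+ n)) = 0.
  rewrite pmulrn qformNr qformMzr qformMzl qform_basis2 (seed_form_mut k_mut sN).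
  by rewrite exchkk !mulr0 oppr0.
have FP : GRing.comm F P.
  apply: FC; apply: commr_prod => a _; apply: commrD; first exact: commr1.
  by apply: commrM; [exact/commr_sym/fpowC | ].
have FX : GRing.comm F (X (- (basis_vec k *+ n))).
  by apply: FC; apply: mon_comm => //; have := q0 1; rewrite mulr1z.
rewrite /= -[P * F]FP -!mulrA [F * (t _ * _)]mulrA -(fpowC K _ F) -mulrA [F * (X _ * P)]mulrA.
rewrite FX !mulrA; congr (_ * _ * _); rewrite -(mulrA (t _)) -(fpowC K _ (X _)).
rewrite !mulrA -fpowD -mulrA monM.
have -> : qform B (- basis_vec k) (- (basis_vec k *+ n)) = 0.
  by have := q0 (-1); rewrite mulrN1z.
rewrite fpow0 mul1r; congr (t _ * X _); last by rewrite -opprD -mulrS.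
lia.
Qed.

(** For eps_ik > 0 the definitions agree.  For eps_ik = - n <= 0, [ladder_opp]
    produces a monomial X_(- n e_k), which cancels the multiple of e_k that
    [lat_mut] adds to e_i. *)
Lemma mutation_rep_basis i :
  mutation_rep (basis_vec i) = quantum_mutation_image k K i.
Proof.
rewrite /mutation_rep pairing_basis lat_mut_basis /quantum_mutation_image.
case: eqP => [->|_]; first by rewrite exchkk ladder0 divr1 (monN K skew).
have qk j : qk_pow k K j = t (m * j%:Z) by rewrite /qk_pow PoszM mulrC.
rewrite -(exchE k_mut i) numq_int lerz0 -/(exch s i k).
case E: (exch s i k) => [n|n].
  case: ifP => [n0|_]; last first.
    rewrite max_l ?oppr_le0 ?lez_nat // mulr0z addr0 absz_nat.
    congr (_ / _); rewrite [RHS]big_add1 /ladder; apply: eq_bigr => a _.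
    by rewrite qk /dilog_factor (monN K skew); congr (1 + t _ * _); lia.
  have -> : n = 0 by lia.
  by rewrite oppr0 maxxx mulr0z addr0 ladder0 divr1 big_geq ?mulr1.
rewrite NegzE opprK lerNl oppr0 lez_nat /= max_r ?lez_nat // ladder_opp.
rewrite mulrA [X _ * _]mulrA -(fpowC K _ (X _)) -(mulrA (t _)) monM -pmulrn addrK.
rewrite qformNr qformDl pmulrn !qformMzr qformMzl !qform_basis2 !mulrA -fpowD.
have -> : - (m * (n.+1 * n.+1)%N)
    - (n.+1%:Z * B i k + n.+1%:Z * n.+1%:Z * B k k) = 0.
  by rewrite !(seed_form_mut k_mut sN) E exchkk NegzE PoszM; ring.
rewrite fpow0 mul1r; congr (_ * _).
by apply: eq_bigr => a _; rewrite qk.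
Qed.

Lemma quantum_mutation_exists : exists f : qpos_hom S T,
  (forall v, f (mon K' v) = mutation_rep v) /\ is_quantum_mutation k f.
Proof.
have sf1 : subtraction_free (1 : K) by rewrite -fpow0; constructor.
have sfP (F : nat -> K) a b : (forall j, subtraction_free (F j)) ->
    subtraction_free (\prod_(a <= j < b) F j).
  by move=> FP; apply: big_ind => // x y; apply: SfMul.
have [i|f fE] := qpos_hom_of_rep (S := S) (T := T)
    mutation_rep_inj mutation_rep_star.
  have sfX := @SfGen _ _ K; have sfq j : subtraction_free (qk_pow k K j).
    exact: SfPow.
  rewrite [M in subtraction_free M]mutation_rep_basis.
  rewrite /quantum_mutation_image; case: eqP => _; first exact/SfInv/sfX.
  case: ifP => _; apply: SfMul (sfX i) _; last apply: SfInv; apply: sfP => j.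
    exact/(SfAdd sf1)/SfMul/sfX/sfq.
  exact/(SfAdd sf1)/SfMul/SfInv/sfX/sfq.
exists f; split=> // i.
by rewrite fgenE fE mutation_rep_basis.
Qed.

End MutationHom.

(** * Relabelling *)

Section Relabelling.
Variables (N : nat) (I J : finType) (s : seed I) (t : seed J) (f : I -> J).
Hypothesis st : seed_iso s t f.

Definition relabel (w : {ffun J -> int}) : {ffun I -> int} := [ffun i => w (f i)].

Lemma seed_form_iso i j : seed_form N t (f i) (f j) = seed_form N s i j.
Proof. by rewrite /seed_form /eps_hat (iso_eps st) (iso_d st). Qed.

Lemma integral_iso : integral_seed N s -> integral_seed N t.
Proof.
have [g fK gK] := iso_bij st; case=> sN sd; split=> [i j|i].
  by rewrite -(gK i) -(gK j) /eps_hat (iso_eps st) (iso_d st); apply: sN.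
by rewrite -(gK i) (iso_d st).
Qed.

Lemma qform_relabel v w :
  qform (seed_form N s) (relabel v) (relabel w) = qform (seed_form N t) v w.
Proof.
have fO := onW_bij predT (iso_bij st).
rewrite /qform (reindex f fO); apply: eq_bigr => i _.
rewrite [RHS](reindex f fO); apply: eq_bigr => j _.
by rewrite !ffunE seed_form_iso.
Qed.

Lemma relabelD v w : relabel (v + w) = relabel v + relabel w.
Proof. by apply/ffunP => i; rewrite !ffunE. Qed.

Lemma relabel_basis i : relabel (basis_vec (f i)) = basis_vec i.
Proof.
by apply/ffunP => j; rewrite !ffunE (inj_eq (bij_inj (iso_bij st))).
Qed.

Variables (K : fraction_field (qtorus (seed_form N s))).
Variables (K' : fraction_field (qtorus (seed_form N t))).
Let S : qpos_ob := QPosOb (seed_form_skew N t) K'.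
Let T : qpos_ob := QPosOb (seed_form_skew N s) K.

Lemma relabelling_exists : exists g : qpos_hom S T,
  forall v, g (mon K' v) = mon K (relabel v).
Proof.
have M0 : mon K (relabel 0) = 1.
  by rewrite -(mon0 K); congr mon; apply/ffunP => i; rewrite !ffunE.
have MM v w : mon K (relabel v) * mon K (relabel w)
    = fpow K (qform (seed_form N t) v w) * mon K (relabel (v + w)).
  by rewrite monM relabelD qform_relabel.
have [g fK gK] := iso_bij st.
apply: (@qpos_hom_of_rep S T _ M0 MM) => [a|v|i].
- pose h (v : {ffun I -> int}) : {ffun J -> int} := [ffun j => v (g j)].
  have relK : cancel relabel h by move=> v; apply/ffunP => j; rewrite !ffunE gK.
  exact: (monomial_map_inj (K := K) relK).
- exact: (fstar_mon (seed_form_skew N s)).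
- by rewrite /= -[i]gK relabel_basis; apply: SfGen.
Qed.

End Relabelling.

(** * The functor on formal compositions *)

Lemma mutation_exists (N : nat) (I : finType) (s s' : seed I) (k : I)
    (k_mut : k \notin frozen s) (ss' : s' = mutate k_mut)
    (K : fraction_field (qtorus (seed_form N s)))
    (K' : fraction_field (qtorus (seed_form N s'))) : integral_seed N s ->
  exists f : qpos_hom (QPosOb (seed_form_skew N s') K')
                      (QPosOb (seed_form_skew N s) K),
    (forall v, f (mon K' v) = mutation_rep k K v) /\ is_quantum_mutation k f.
Proof. by move=> sN; subst s'; apply: quantum_mutation_exists. Qed.

Lemma integral_transf (N : nat) x y : transf x y ->
  integral_seed N (seed_of x) -> integral_seed N (seed_of y).
Proof.
elim=> [I s s' k k_mut -> /=|I J s t f st /=|{}x {}y z _ IH1 _ IH2 /IH2 //].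
  exact: integral_mutate.
exact: (integral_iso st).
Qed.

Section Functor.
Variables (x0 : any_seed) (N : nat).
Hypothesis x0N : integral_seed N (seed_of x0).
Variable K : forall x : Ob (special_groupoid x0),
  fraction_field (qtorus (seed_form N (seed_of (sval x)))).

Definition ob_at x (hx : equivalent x0 x) : Ob (special_groupoid x0) :=
  exist _ x hx.

Definition torus_at x (hx : equivalent x0 x) : qpos_ob :=
  seed_qtorus (K (ob_at hx)).

Lemma integral_at x : equivalent x0 x -> integral_seed N (seed_of x).
Proof. by case=> c; apply: integral_transf c x0N. Qed.

Lemma equivalent_trans x y : equivalent x0 x -> transf x y -> equivalent x0 y.
Proof. by case=> a b; constructor; exact: Comp b a. Qed.

Definition mut_hom (I : finType) (s s' : seed I) (k : I)
    (k_mut : k \notin frozen s) (ss' : s' = mutate k_mut)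
    (hx : equivalent x0 (AnySeed s)) (hy : equivalent x0 (AnySeed s')) :
    qpos_hom (torus_at hy) (torus_at hx) :=
  sval (cid (mutation_exists ss' (K (ob_at hx)) (K (ob_at hy)) (integral_at hx))).

Definition iso_hom (I J : finType) (s : seed I) (t : seed J) (f : I -> J)
    (st : seed_iso s t f)
    (hx : equivalent x0 (AnySeed s)) (hy : equivalent x0 (AnySeed t)) :
    qpos_hom (torus_at hy) (torus_at hx) :=
  sval (cid (relabelling_exists st (K (ob_at hx)) (K (ob_at hy)))).

(** Equivalence proofs enter only through the choice of the fraction fields;
    proof irrelevance makes those chosen at intermediate seeds immaterial. *)
Fixpoint transf_hom x y (c : transf x y) :
    forall (hx : equivalent x0 x) (hy : equivalent x0 y),
    qpos_hom (torus_at hy) (torus_at hx) :=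
  match c in transf x y return forall hx hy, qpos_hom (torus_at hy) (torus_at hx)
  with
  | Mut _ _ _ _ _ ss' => mut_hom ss'
  | Iso _ _ _ _ _ st => iso_hom st
  | Comp _ _ _ a b => fun hx hz =>
      let hy := equivalent_trans hx b in
      qpos_comp (transf_hom b hx hy) (transf_hom a hy hz)
  end.

Lemma mut_homE (I : finType) (s s' : seed I) (k : I)
    (k_mut : k \notin frozen s) (ss' : s' = mutate k_mut)
    (hx : equivalent x0 (AnySeed s)) (hy : equivalent x0 (AnySeed s')) v :
  mut_hom ss' hx hy (mon (torus_at hy) v)
    = mutation_rep k (K (ob_at hx)) v.
Proof. by rewrite /mut_hom; case: cid => f /= [fE _]; apply: fE. Qed.

Lemma mut_hom_gen (I : finType) (s s' : seed I) (k : I)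
    (k_mut : k \notin frozen s) (ss' : s' = mutate k_mut)
    (hx : equivalent x0 (AnySeed s)) (hy : equivalent x0 (AnySeed s')) :
  is_quantum_mutation k (mut_hom ss' hx hy).
Proof. by rewrite /mut_hom; case: cid => f /= []. Qed.

Lemma iso_homE (I J : finType) (s : seed I) (t : seed J) (f : I -> J)
    (st : seed_iso s t f)
    (hx : equivalent x0 (AnySeed s)) (hy : equivalent x0 (AnySeed t)) v :
  iso_hom st hx hy (mon (torus_at hy) v) = mon (torus_at hx) (relabel f v).
Proof. by rewrite /iso_hom; case: cid => g /= gE; apply: gE. Qed.

Lemma iso_hom_gen (I J : finType) (s : seed I) (t : seed J) (f : I -> J)
    (st : seed_iso s t f)
    (hx : equivalent x0 (AnySeed s)) (hy : equivalent x0 (AnySeed t)) :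
  is_relabelling f (iso_hom st hx hy).
Proof. by move=> i; rewrite !fgenE iso_homE (relabel_basis st). Qed.

Lemma transf_hom_comp x y z (a : transf y z) (b : transf x y) hx hy hz :
  transf_hom (Comp a b) hx hz = qpos_comp (transf_hom b hx hy) (transf_hom a hy hz).
Proof. by rewrite /=; rewrite (Prop_irrelevance (equivalent_trans hx b) hy). Qed.

Lemma transf_hom_id x hx : transf_hom (transf_id x) hx hx = qpos_id (torus_at hx).
Proof.
case: x hx => I s hx; apply: qpos_hom_fgen_eq => i.
exact: (iso_hom_gen (seed_iso_id s) hx hx i).
Qed.

End Functor.

(** * The rank two Y-system *)

(** The triple [(m, (a, b))] stands for [u^m] times the normalised monomial of
    exponents a in x = z_0 and b in y = z_(-1), where x y = u^(2p) y x.  A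
    Laurent polynomial whose coefficients are natural numbers is the sequence
    of its monomials, so that equality is equality up to permutation. *)
Definition hmon : Type := (int * (int * int))%type.
Definition laurent : Type := seq hmon.

Definition hu (k : int) : hmon := (k, (0, 0)).
Definition hX (a b : int) : hmon := (0, (a, b)).

Section Laurent.
Variable p : nat.

Definition hmul (w w' : hmon) : hmon :=
  (w.1 + w'.1 + p%:Z * (w.2.1 * w'.2.2 - w'.2.1 * w.2.2),
   (w.2.1 + w'.2.1, w.2.2 + w'.2.2)).

Definition lmul (P Q : laurent) : laurent := [seq hmul w w' | w <- P, w' <- Q].

Definition one_plus (k : int) (P : laurent) : laurent :=
  hu 0 :: map (hmul (hu k)) P.

Fixpoint ldilog (c : int) (n : nat) (P : laurent) : laurent :=
  if n is n'.+1 then lmul (ldilog c n' P) (one_plus (c * (2 * n'%:Z + 1)) P)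
  else [:: hu 0].

Definition hle (w w' : hmon) : bool :=
  (w.1 < w'.1) || (w.1 == w'.1) &&
  ((w.2.1 < w'.2.1) || (w.2.1 == w'.2.1) && (w.2.2 <= w'.2.2)).

Definition laurent_eq (P Q : laurent) : bool := sort hle P == sort hle Q.

(** The recursion is z_(n+1) z_(n-1) = prod_(a < ys_deg n) (1 + u^(c (2a+1)) z_n)
    with c = ys_exp n: the roles of i and j alternate, and with them q_i = u^p
    and q_j = u. *)
Definition ys_exp (n : nat) : nat := if odd n then 1 else p.
Definition ys_deg (n : nat) : nat := if odd n then p else 1.

(** Entry n of the sequence is z_(n-1). *)
Definition ys_check (Ls : seq laurent) : bool :=
  [&& nth [::] Ls 0 == [:: hX 0 1], nth [::] Ls 1 == [:: hX 1 0],
      [::] \notin Ls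
    & all (fun n => laurent_eq (lmul (nth [::] Ls n.+2) (nth [::] Ls n))
                      (ldilog (ys_exp n) (ys_deg n) (nth [::] Ls n.+1)))
          (iota 0 (size Ls - 2))].

Variables (R : unitRingType) (E : hmon -> R).
Hypothesis E1 : E (hu 0) = 1.
Hypothesis EM : forall w w', E (hmul w w') = E w * E w'.

Definition leval (P : laurent) : R := \sum_(w <- P) E w.
Hypothesis EU : forall P, P != [::] -> leval P \is a GRing.unit.

Lemma leval1 w : leval [:: w] = E w.
Proof. exact: big_seq1. Qed.

Lemma leval_lmul P Q : leval (lmul P Q) = leval P * leval Q.
Proof.
rewrite /leval big_allpairs_dep mulr_suml; apply: eq_bigr => w _.
by rewrite mulr_sumr; apply: eq_bigr => w' _; apply: EM.
Qed.

Lemma leval_one_plus k P : leval (one_plus k P) = 1 + E (hu k) * leval P.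
Proof.
rewrite /leval big_cons E1 big_map mulr_sumr; congr (_ + _).
by apply: eq_bigr => w _; apply: EM.
Qed.

Lemma leval_eq P Q : laurent_eq P Q -> leval P = leval Q.
Proof.
move=> /eqP PQ; apply: perm_big; apply: (perm_trans (y := sort hle P)).
  by rewrite perm_sym perm_sort.
by rewrite PQ perm_sort.
Qed.

Lemma one_plus_unit k P : 1 + E (hu k) * leval P \is a GRing.unit.
Proof. by rewrite -leval_one_plus; apply: EU. Qed.

Definition ys_factor (c : int) (z : R) (a : int) : R :=
  1 + E (hu (c * (2 * a + 1))) * z.

Lemma leval_ldilog c n P :
  leval (ldilog c n P) = ladder (ys_factor c (leval P)) n.
Proof.
elim: n => [|n IH]; first by rewrite ladder0 leval1.
have -> : n.+1%:Z = n%:Z + 1 by lia.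
rewrite /= leval_lmul IH leval_one_plus ladderSr // => a.
exact: one_plus_unit.
Qed.

Definition ys_step (n : nat) (yz : R * R) : R * R :=
  (yz.2, ladder (ys_factor (ys_exp n) yz.2) (ys_deg n) / yz.1).

Fixpoint ysystem (n : nat) : R * R :=
  if n is n'.+1 then ys_step n' (ysystem n') else (E (hX 0 1), E (hX 1 0)).

Lemma ysystemE Ls n : ys_check Ls -> (n.+1 < size Ls)%N ->
  ysystem n = (leval (nth [::] Ls n), leval (nth [::] Ls n.+1)).
Proof.
case/and4P => /eqP L0 /eqP L1 Ls0 /allP Lall.
elim: n => [|n IH] nL; first by rewrite L0 L1 !leval1.
rewrite /= IH ?(ltn_trans _ nL) // /ys_step /=; congr pair.
have nz : nth [::] Ls n != [::].
  apply: contraNneq Ls0 => <-; apply: mem_nth; apply: leq_trans nL.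
  by rewrite ltnW.
apply: (mulIr (EU nz)); rewrite divrK ?EU // -leval_ldilog -leval_lmul.
apply/esym/leval_eq/Lall; rewrite mem_iota add0n leq0n /=; lia.
Qed.

End Laurent.

Definition lx : laurent := [:: hX 1 0].
Definition ly : laurent := [:: hX 0 1].
Definition lxV : laurent := [:: hX (-1) 0].
Definition lyV : laurent := [:: hX 0 (-1)].

(** The solutions.  Their first entries come from the recursion started at
    (y, x); as the period is known in advance, their last entries come from
    the recursion run backwards from the same pair. *)
Definition first_var p : laurent := lmul p (ldilog p p 1 lx) lyV.
Definition second_var p : laurent := lmul p (ldilog p 1 p (first_var p)) lxV.
Definition last_var p : laurent := lmul p lxV (ldilog p 1 p ly).
Definition before_last_var p : laurent := lmul p lyV (ldilog p p 1 (last_var p)).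

Definition sol_A2 : seq laurent :=
  [:: ly; lx; first_var 1; second_var 1; last_var 1; ly; lx].

Definition sol_B2 : seq laurent :=
  [:: ly; lx; first_var 2; second_var 2; before_last_var 2; last_var 2; ly; lx].

(** In type G2 the even variables are the cubes of the cluster variables A_n,
    up to powers of u, and A_(n+1) A_(n-1) = 1 + u A_n for odd n.  Only z_0, not
    its cube root A_0, lies in the torus, but A_4 / A_0 does: it is this
    polynomial, found by dividing 1 + u^-1 z_5 by 1 + u y. *)
Definition g2_poly : laurent :=
  [:: (-1, (-1, -1)); (-1, (0, -1)); (-1, (-1, 0)); (1, (-1, 0)); (1, (-1, 1))].

(** Conjugation by a fractional power of x, namely by A_0 for k = 2. *)
Definition twist_y (k : int) (P : laurent) : laurent :=
  [seq (w.1 + k * w.2.2, w.2) | w <- P].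

(** z_3, from 1 + u z_3 = g2_poly (1 + u^-1 z_1). *)
Definition g2_third : laurent :=
  map (hmul 3 (hu (-1))) (rem (hu 0) (lmul 3 g2_poly (one_plus 3 (-1) (first_var 3)))).

(** z_4, the cube of A_4 = g2_poly A_0 with the powers of A_0 collected on the
    right. *)
Definition g2_fourth : laurent :=
  lmul 3 (lmul 3 (lmul 3 g2_poly (twist_y 2 g2_poly)) (twist_y 4 g2_poly)) lx.

Definition sol_G2 : seq laurent :=
  [:: ly; lx; first_var 3; second_var 3; g2_third; g2_fourth;
      before_last_var 3; last_var 3; ly; lx].

Lemma sol_A2P : ys_check 1 sol_A2.
Proof. by vm_compute. Qed.

Lemma sol_B2P : ys_check 2 sol_B2.
Proof. by vm_compute. Qed.

Lemma sol_G2P : ys_check 3 sol_G2.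
Proof. by vm_compute. Qed.

Lemma B2_factor : laurent_eq (one_plus 2 1 (before_last_var 2))
  (lmul 2 (lmul 2 (one_plus 2 (-1) ly) lxV) (one_plus 2 (-1) (first_var 2))).
Proof. by vm_compute. Qed.

Lemma G2_factor3 : laurent_eq (one_plus 3 1 g2_third)
  (lmul 3 g2_poly (one_plus 3 (-1) (first_var 3))).
Proof. by vm_compute. Qed.

Lemma G2_factor5 : laurent_eq (one_plus 3 (-1) (before_last_var 3))
  (lmul 3 g2_poly (one_plus 3 1 ly)).
Proof. by vm_compute. Qed.

(** * Powers of sigma_ij o mu_i *)

Lemma relabel_tpermK (I : finType) (i j : I) :
  involutive (relabel (tperm i j)).
Proof. by move=> v; apply/ffunP => l; rewrite !ffunE tpermK. Qed.

Section SigmaMu.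
Variables (x0 : any_seed) (N : nat).
Hypothesis x0N : integral_seed N (seed_of x0).
Hypothesis N_gt0 : (0 < N)%N.
Variable K : forall x : Ob (special_groupoid x0),
  fraction_field (qtorus (seed_form N (seed_of (sval x)))).
Local Notation hom := (transf_hom x0N K).

Definition transf_morph x y (c : transf x y) hx hy :
    {rmorphism K (ob_at hy) -> K (ob_at hx)} := qpos_rmorphism (hom c hx hy).

Lemma transf_morph_pow x y (c : transf x y) hx hy m :
  transf_morph c hx hy (fpow _ m) = fpow _ m.
Proof. exact: (psm_pow (qmapP (hom c hx hy))). Qed.

Variables (I : finType) (i j : I).
Hypothesis ij : i != j.

Section Step.
Variables (t u v : seed I) (i_mut : i \notin frozen t).
Hypothesis tu : u = mutate i_mut.
Hypothesis uv : seed_iso u v (tperm i j).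

Lemma sigma_mu_eps a b : eps v (tperm i j a) (tperm i j b) = mutate_eps t i a b.
Proof. by rewrite (iso_eps uv) tu. Qed.

Lemma sigma_mu_frozen l : (tperm i j l \in frozen v) = (l \in frozen t).
Proof. by rewrite (iso_frozen uv) tu. Qed.

Lemma sigma_mu_exp l : qk_exp N v (tperm i j l) = qk_exp N t l.
Proof. by rewrite /qk_exp (iso_d uv) tu. Qed.

Lemma sigma_mu_pairing_j w :
  pairing v j (relabel (tperm i j) (lat_mut t i w)) = - pairing t i w.
Proof.
have -> : pairing v j (relabel (tperm i j) (lat_mut t i w))
    = - pairing t i (lat_mut t i w); last by rewrite pairing_lat_mut.
rewrite /pairing (reindex_inj (@perm_inj _ (tperm i j))) -sumrN.
apply: eq_bigr => l _; rewrite [in LHS]ffunE tpermK /exch -mulrN; congr (_ * _).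
rewrite -[X in eps v _ X](tpermL i j) sigma_mu_eps /mutate_eps eqxx orbT.
exact: numqN.
Qed.

(** [lat_mut] preserves the form and, as eps_ji >= 0, fixes e_j. *)
Lemma sigma_mu_pairing_i w : integral_seed N t -> j \notin frozen t -> 0 <= eps t j i ->
  pairing v i (relabel (tperm i j) (lat_mut t i w)) = pairing t j w.
Proof.
move=> tN jt eji.
have uN : integral_seed N u by rewrite tu; apply: integral_mutate.
have ju : j \notin frozen u by rewrite tu.
have -> : pairing v i (relabel (tperm i j) (lat_mut t i w))
    = pairing u j (lat_mut t i w).
  rewrite /pairing (reindex_inj (@perm_inj _ (tperm i j))).
  apply: eq_bigr => l _; rewrite [in LHS]ffunE tpermK /exch; congr (_ * numq _).
  by rewrite -[X in eps v _ X](tpermR i j) (iso_eps uv).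
have mE : qk_exp N u j = qk_exp N t j by rewrite /qk_exp tu.
have m0 : qk_exp N t j != 0.
  rewrite /qk_exp; have /dvdnP [d dE] := tN.2 j; move: N_gt0; rewrite dE.
  by rewrite muln_gt0 mulnK ?d_gt0 // => /andP [d0 _]; case: d d0 {dE}.
apply: (mulfI m0); rewrite -{1}mE -(qform_pairing ju uN) -(qform_pairing jt tN).
subst u; rewrite qform_lat_mut // lat_mutK lat_mut_basis eq_sym (negPf ij).
rewrite max_l ?mulr0z ?addr0 // oppr_le0 -(ler0z rat) exchE //.
Qed.

Variables (s : seed I) (c : transf (AnySeed s) (AnySeed t)).
Variables (hs : equivalent x0 (AnySeed s)) (ht : equivalent x0 (AnySeed t)).
Variable hv : equivalent x0 (AnySeed v).
Let F := transf_morph c hs ht.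
Let F' := transf_morph (Comp (Iso uv) (Comp (Mut tu) c)) hs hv.

Lemma sigma_mu_comp x : F' x
  = F (mut_hom x0N K tu ht (equivalent_trans ht (Mut tu))
      (iso_hom K uv (equivalent_trans ht (Mut tu)) hv x)).
Proof.
pose hu' := equivalent_trans ht (Mut tu).
rewrite /F' /transf_morph -qpos_rmorphismE (transf_hom_comp _ _ _ _ _ hu').
by rewrite (transf_hom_comp _ _ _ _ _ ht).
Qed.

Lemma sigma_mu_mon w : F' (mon _ w)
  = F (mutation_rep i (K (ob_at ht)) (relabel (tperm i j) w)).
Proof. by rewrite sigma_mu_comp iso_homE mut_homE. Qed.

Lemma sigma_mu_gen l : F' (fgen _ l)
  = F (quantum_mutation_image i (K (ob_at ht)) (tperm i j l)).
Proof.
rewrite sigma_mu_comp -{1}[l](tpermK i j) (iso_hom_gen K uv).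
by rewrite (mut_hom_gen x0N K tu).
Qed.

End Step.

Arguments sigma_mu_mon {t u v i_mut} tu uv {s} c hs ht {hv}.
Arguments sigma_mu_gen {t u v i_mut} tu uv {s} c hs ht {hv}.

Section Finite.
Variables (s : seed I) (hs : equivalent x0 (AnySeed s)) (p : nat).
Hypothesis i_mut : i \notin frozen s.
Hypothesis j_mut : j \notin frozen s.
Hypothesis eij : eps s i j = - p%:R.
Hypothesis eji : eps s j i = 1.
Local Notation Ks := (K (ob_at hs)).
Local Notation B := (seed_form N s).
Local Notation m := (qk_exp N s j).
Local Notation e_ := (@basis_vec I).
Let skew := seed_form_skew N s.
Let sN : integral_seed N s := integral_at x0N hs.

Lemma exch_ij : exch s i j = - p%:Z.
Proof. by rewrite /exch eij -(numq_int (- p%:Z)) rmorphN. Qed.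

Lemma exch_ji : exch s j i = 1.
Proof. by rewrite /exch eji. Qed.

Lemma exp_i : qk_exp N s i = p%:Z * m.
Proof.
apply: (@intr_inj rat); rewrite intrM !qk_expE //.
have := eps_skew s i j; rewrite eij eji mul1r mulNr => /oppr_inj E.
by rewrite [RHS]mulrCA -E mulrC.
Qed.

(** x = X_i^-1, y = X_j and u = q_j; u is the power m of the base parameter. *)
Definition rank2_mon (w : hmon) : Ks :=
  fpow Ks (m * w.1) * mon Ks (e_ j *~ w.2.2 - e_ i *~ w.2.1).
Local Notation E := rank2_mon.

Lemma rank2_mon1 : E (hu 0) = 1.
Proof. by rewrite /rank2_mon !mulr0 fpow0 !mulr0z subrr mon0 mulr1. Qed.

Lemma rank2_mon_u k : E (hu k) = fpow Ks (m * k).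
Proof. by rewrite /rank2_mon /= !mulr0z subrr mon0 mulr1. Qed.

Lemma rank2_mon_x : E (hX 1 0) = mon Ks (- e_ i).
Proof. by rewrite /rank2_mon /= mulr0 fpow0 mulr0z mulr1z mul1r sub0r. Qed.

Lemma rank2_mon_y : E (hX 0 1) = mon Ks (e_ j).
Proof. by rewrite /rank2_mon /= mulr0 fpow0 mulr0z mulr1z mul1r subr0. Qed.

Lemma rank2_monM w w' : E (hmul p w w') = E w * E w'.
Proof.
rewrite /rank2_mon -[RHS]mulrA [mon _ _ * (_ * _)]mulrA -(fpowC Ks _ (mon _ _)).
rewrite !mulrA -fpowD -[RHS]mulrA monM mulrA -fpowD; congr (fpow _ _ * mon _ _).
  rewrite !(qformDl, qformDr, qformNl, qformNr, qformMzl, qformMzr) !qform_basis2.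
  rewrite !(seed_form_mut j_mut sN) !exchkk exch_ij.
  rewrite (seed_form_skew N s j i) (seed_form_mut j_mut sN) exch_ij.
  have -> : B i i = 0 by rewrite (seed_form_mut i_mut sN) exchkk mulr0.
  by rewrite /=; ring.
by rewrite /= !mulrzDr opprD addrACA.
Qed.

Lemma rank2_mon_unit P : P != [::] -> leval E P \is a GRing.unit.
Proof. by move=> P0; apply/frac_unit/sum_mon_neq0. Qed.

Local Notation ys := (ysystem p E).
Local Notation factor n := (ys_factor E (ys_exp p n) (ys n).2).

(** The pairings with e_i and e_j of a lattice vector carried along the
    mutations, and the image of its monomial, after n steps. *)
Fixpoint chain (A D : int) (W : Ks) (n : nat) : int * int * Ks :=
  if n is n'.+1 then
    let: (A', D', W') := chain A D W n' in
    (D', - A', W' / ladder (factor n') A')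
  else (A, D, W).

(** Everything that is needed to take one more step.  The vector w is the one
    whose transport back to the first seed is v: each step modifies it only at
    i and j. *)
Definition state n (t : seed I) (c : transf (AnySeed s) (AnySeed t))
    (ht : equivalent x0 (AnySeed t)) : Prop :=
  let F := transf_morph c hs ht in
  [/\ [/\ i \notin frozen t, j \notin frozen t,
         eps t i j = - (ys_exp p n)%:R & eps t j i = (ys_deg p n)%:R],
      qk_exp N t i = (ys_exp p n)%:Z * m /\ qk_exp N t j = (ys_deg p n)%:Z * m,
      F (mon _ (e_ j)) = (ys n).1 /\ F (mon _ (- e_ i)) = (ys n).2
    & forall v : {ffun I -> int}, exists w : {ffun I -> int},
        (forall l, l != i -> l != j -> w l = v l) /\
        (pairing t i w, pairing t j w, F (mon _ w))
          = chain (pairing s i v) (pairing s j v) (mon _ v) n].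

Lemma state0 (hs' : equivalent x0 (AnySeed s)) :
  state 0 (transf_id (AnySeed s)) hs'.
Proof.
rewrite (Prop_irrelevance hs' hs).
have Fid x : transf_morph (transf_id (AnySeed s)) hs hs x = x.
  by rewrite /transf_morph -qpos_rmorphismE transf_hom_id.
split.
- by split=> //; rewrite eij.
- by rewrite exp_i mul1r.
- by rewrite !Fid [ys 0]/= rank2_mon_x rank2_mon_y.
- by move=> v; exists v; split=> //; rewrite Fid.
Qed.

Lemma stateS n (t u v : seed I) (c : transf (AnySeed s) (AnySeed t))
    (it : i \notin frozen t) (tu : u = mutate it)
    (uv : seed_iso u v (tperm i j)) ht hv :
  state n c ht -> state n.+1 (Comp (Iso uv) (Comp (Mut tu) c)) hv.
Proof.
case=> [[_ jt tij tji] [ti tj] [Fj Fi] Fv].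
set F := transf_morph c hs ht in Fj Fi Fv.
have Fpow k : F (fpow _ k) = fpow _ k by apply: transf_morph_pow.
have tN := integral_at x0N ht; rewrite /= in tN.
have factorE a : F (dilog_factor i (K (ob_at ht)) a) = factor n a.
  rewrite rmorphD rmorph1 rmorphM Fpow Fi /ys_factor.
  by rewrite rank2_mon_u ti; congr (1 + fpow _ _ * _); ring.
have exp_deg : ys_exp p n.+1 = ys_deg p n /\ ys_deg p n.+1 = ys_exp p n.
  by rewrite /ys_exp /ys_deg /=; case: (odd n).
have vij : eps v i j = - eps t j i.
  rewrite -[X in eps v X _](tpermR i j) -[X in eps v _ X](tpermL i j).
  rewrite (sigma_mu_eps tu uv) /mutate_eps.
  by rewrite eqxx orbT.
have vji : eps v j i = - eps t i j.
  rewrite -[X in eps v X _](tpermL i j) -[X in eps v _ X](tpermR i j).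
  rewrite (sigma_mu_eps tu uv) /mutate_eps.
  by rewrite eqxx.
have dU a : dilog_factor i (K (ob_at ht)) a \is a GRing.unit.
  exact: dilog_factor_unit.
have F'j : transf_morph (Comp (Iso uv) (Comp (Mut tu) c)) hs hv (mon _ (e_ j))
   = (ys n).2.
  rewrite (sigma_mu_mon tu uv c hs ht) -[X in e_ X](tpermL i j) (relabel_basis uv).
  rewrite /mutation_rep pairing_basis exchkk ladder0 divr1 lat_mut_basis eqxx.
  exact: Fi.
have F'i : transf_morph (Comp (Iso uv) (Comp (Mut tu) c)) hs hv (mon _ (e_ i))
   = (ys n).1 / ladder (factor n) (ys_deg p n).
  rewrite (sigma_mu_mon tu uv c hs ht) -[X in e_ X](tpermR i j) (relabel_basis uv).
  have eE : exch t j i = (ys_deg p n).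
    by rewrite /exch tji -[RHS]numq_int.
  rewrite /mutation_rep pairing_basis lat_mut_basis eq_sym (negPf ij) eE.
  rewrite max_l ?oppr_le0 // mulr0z addr0 rmorphM rmorphV ?ladder_unit //.
  by rewrite Fj rmorph_ladder // (eq_ladder factorE).
split.
- split; first by rewrite -[X in X \notin _](tpermR i j) (sigma_mu_frozen tu uv).
  + by rewrite -[X in X \notin _](tpermL i j) (sigma_mu_frozen tu uv).
  + by rewrite vij tji exp_deg.1.
  + by rewrite vji tij opprK exp_deg.2.
- split.
    by rewrite -[X in qk_exp _ _ X](tpermR i j) (sigma_mu_exp tu uv) tj exp_deg.1.
  by rewrite -[X in qk_exp _ _ X](tpermL i j) (sigma_mu_exp tu uv) ti exp_deg.2.
- split=> //; rewrite (monN _ (seed_form_skew N v)) rmorphV ?mon_unit //.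
    have lU : ladder (factor n) (ys_deg p n) \is a GRing.unit.
      by rewrite -(eq_ladder factorE) -rmorph_ladder // rmorph_unit ?ladder_unit.
    rewrite F'i invrM ?unitrV ?invrK // -Fj.
    by rewrite rmorph_unit // mon_unit //; apply: seed_form_skew.
  exact: seed_form_skew.
move=> w0; have [w [wl]] := Fv w0; rewrite [chain _ _ _ n.+1]/=.
case: (chain _ _ _ n) => [[A D] W] [wA wD wW].
have {}wW : F (mon _ w) = W by exact: wW.
exists (relabel (tperm i j) (lat_mut t i w)); split=> [l li lj|].
  have lE : tperm i j l = l by rewrite tpermD // eq_sym.
  by rewrite !ffunE lE (negPf li) wl.
rewrite (sigma_mu_pairing_j tu uv) (sigma_mu_pairing_i tu uv) ?tji ?ler0n //.
rewrite wA wD; congr (_, _, _).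
rewrite (sigma_mu_mon tu uv c hs ht) relabel_tpermK /mutation_rep lat_mutK.
rewrite pairing_lat_mut rmorphM rmorphV ?ladder_unit // -/F wW wA.
by rewrite rmorph_ladder // (eq_ladder factorE).
Qed.

Lemma ysE Ls n : ys_check p Ls -> (n.+1 < size Ls)%N ->
  ys n = (leval E (nth [::] Ls n), leval E (nth [::] Ls n.+1)).
Proof.
by move=> LsP nL; apply: (ysystemE rank2_mon1 rank2_monM rank2_mon_unit LsP nL).
Qed.

Lemma ladder_factor1 n Ls : ys_check p Ls -> (n.+1 < size Ls)%N -> odd n ->
  ladder (factor n) 1 = leval E (one_plus p 1 (nth [::] Ls n.+1)) /\
  ladder (factor n) (-1) = (leval E (one_plus p (-1) (nth [::] Ls n.+1)))^-1.
Proof.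
move=> LsP nL on; rewrite !(leval_one_plus rank2_mon1 rank2_monM).
rewrite ladder1 (ladderN1 (factor n)) /ys_factor /ys_exp on (ysE LsP nL).
by split; [|congr _^-1]; congr (1 + E (hu _) * _).
Qed.

(** The form is non-degenerate on the plane of e_i and e_j. *)
Lemma pairing_supported (d : {ffun I -> int}) :
  (forall l, l != i -> l != j -> d l = 0) ->
  pairing s i d = d j /\ pairing s j d = - (p%:Z * d i).
Proof.
move=> dij; have S2 (F : I -> int) : \sum_l d l * F l = d i * F i + d j * F j.
  rewrite (bigD1 i) //= (bigD1 j) 1?eq_sym //= big1 ?addr0 // => l /andP [li lj].
  by rewrite dij // mul0r.
rewrite /pairing !S2 !exchkk exch_ij exch_ji; split; ring.
Qed.

Lemma chain00 W n : chain 0 0 W n = (0, 0, W).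
Proof. by elim: n => //= n ->; rewrite oppr0 ladder0 divr1. Qed.

(** The final pairings are those of v + d e_i, which by non-degeneracy is the
    vector reached after n steps, and the image of its monomial is that same
    monomial.  Hence X_v is fixed if X_i is. *)
Definition returns (n : nat) (r : int) : Prop :=
  exists d : int, forall v, pairing s i v = 0 -> pairing s j v = r ->
    chain 0 r (mon _ v) n = (0, r - p%:Z * d, mon _ (v + e_ i *~ d)).

Lemma returns0 n : returns n 0.
Proof.
by exists 0 => v _ _; rewrite chain00 mulr0 subrr mulr0z addr0.
Qed.

Hypothesis p_gt0 : (0 < p)%N.

(** The vectors v with X_v fixed form a group.  It contains e_i and e_j by
    periodicity and, up to sign, a vector e_l + a e_i + b e_j with pairings
    (0, r), where r is one of the values that [returns]. *)
Lemma state_trivial n (c : transf (AnySeed s) (AnySeed s)) :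
  state n c hs -> ys n = (E (hX 0 1), E (hX 1 0)) ->
  (forall b : int, exists a : int, returns n (b - p%:Z * a)
                                   \/ returns n (p%:Z * a - b)) ->
  forall l, transf_morph c hs hs (fgen _ l) = fgen _ l.
Proof.
set F := transf_morph c hs hs => -[_ _ [Fj Fi] Fv] ysn ret.
have {}Fj : F (mon _ (e_ j)) = mon _ (e_ j) by rewrite Fj ysn -rank2_mon_y.
have {}Fi : F (mon _ (- e_ i)) = mon _ (- e_ i) by rewrite Fi ysn -rank2_mon_x.
pose P v := F (mon _ v) = mon _ v.
have P0 : P 0 by rewrite /P mon0 rmorph1.
have PB u v : P u -> P v -> P (u - v).
  rewrite /P monD monN // !rmorphM rmorphV ?mon_unit // => -> ->.
  by rewrite [F (fpow _ _)]transf_morph_pow.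
have PN v : P v -> P (- v) by rewrite -sub0r; apply: PB.
have PD u v : P u -> P v -> P (u + v).
  by move=> Pu Pv; rewrite -[v]opprK; apply/PB/PN.
have PM u d : P u -> P (u *~ d).
  move=> Pu; elim/int_step_ind: d => [|d Pd|d Pd]; first by rewrite mulr0z.
    by rewrite mulrzDr; apply: PD => //; rewrite mulr1z.
  have -> : u *~ d = u *~ (d + 1) - u by rewrite mulrzDr mulr1z addrK.
  exact: PB.
have Pj : P (e_ j) by [].
have Pi : P (e_ i) by rewrite -[e_ i]opprK; apply: PN.
have Pret r v : returns n r -> pairing s i v = 0 -> pairing s j v = r -> P v.
  case=> d rd vi vj; have [w [wv]] := Fv v; rewrite vi vj rd // => -[wi wj wF].
  have [|di dj] := pairing_supported (d := w - (v + e_ i *~ d)).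
    move=> l li lj; rewrite !ffunE ffunMzE ffunE eq_sym (negPf li) mul0rz.
    by rewrite wv // addr0 subrr.
  have piz : pairing s i (e_ i *~ d) = 0 by rewrite pairing_basisMz exchkk mulr0.
  have pjz : pairing s j (e_ i *~ d) = - (p%:Z * d).
    by rewrite pairing_basisMz exch_ij; ring.
  have wE : w = v + e_ i *~ d.
    apply/eqP; rewrite -subr_eq0; apply/eqP/ffunP => l; rewrite [RHS]ffunE.
    have [->|li] := eqVneq l i.
      have : p%:Z * (w - (v + e_ i *~ d)) i = 0.
        by apply: oppr_inj; rewrite -dj pairingB pairingD pjz vj wj; ring.
      by move=> /eqP; rewrite mulf_eq0 eqz_nat eqn0Ngt p_gt0 /= => /eqP.
    have [->|lj] := eqVneq l j.
      by rewrite -di pairingB pairingD piz vi wi.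
    by rewrite !ffunE ffunMzE ffunE eq_sym (negPf li) mul0rz wv // addr0 subrr.
  have Pw : P w by rewrite /P [in RHS]wE; exact: wF.
  have -> : v = w - e_ i *~ d by rewrite wE addrK.
  by apply: PB => //; apply: PM.
move=> l; have [a ra] := ret (exch s l j).
(* The multiple of e_j cancels the pairing with e_i, that of e_i brings the
   pairing with e_j to the value provided by ret. *)
pose v := e_ l + e_ i *~ a - e_ j *~ exch s l i.
have vi : pairing s i v = 0.
  rewrite pairingB pairingD !pairing_basisMz pairing_basis exchkk exch_ji.
  by ring.
have vj : pairing s j v = exch s l j - p%:Z * a.
  rewrite pairingB pairingD !pairing_basisMz pairing_basis exchkk exch_ij.
  by ring.
suff Pv : P v.
  have -> : fgen Ks l = mon Ks (v - e_ i *~ a + e_ j *~ exch s l i).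
    by rewrite fgenE /v addrAC subrK addrK.
  by apply: PD; [apply: PB => //|]; apply: PM.
case: ra => [r1|r2]; first exact: Pret r1 vi vj.
rewrite -[v]opprK; apply/PN/(Pret _ _ r2); first by rewrite pairingN vi oppr0.
by rewrite pairingN vj opprB.
Qed.

(** Along a chain that starts with pairings (0, r), the factors acquired at
    even steps are trivial. *)
Lemma chain2 A D W n D' W' : chain A D W n = (0, D', W') ->
  chain A D W n.+2 = (0, - D', W' / ladder (factor n.+1) D').
Proof. by move=> e /=; rewrite e oppr0 ladder0 divr1. Qed.

End Finite.

Lemma sigma_mu_state n (s t : seed I) (c : transf (AnySeed s) (AnySeed t)) :
  @sigma_mu_power I i j n s t c -> forall p hs ht,
  i \notin frozen s -> j \notin frozen s ->
  eps s i j = - p%:R -> eps s j i = 1 -> state hs p n c ht.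
Proof.
move=> Hc p hs ht; elim: Hc hs ht => {n s t c} [s|n s t u v c it tu uv _ IH].
  by move=> hs ht *; apply: state0.
move=> hs hv si sj sij sji.
apply: (stateS tu uv (ht := equivalent_trans hs c)).
exact: IH.
Qed.

Section B2.
Variables (s : seed I) (hs : equivalent x0 (AnySeed s)).
Hypotheses (si : i \notin frozen s) (sj : j \notin frozen s).
Hypotheses (sij : eps s i j = - 2%:R) (sji : eps s j i = 1).
Local Notation E := (rank2_mon hs).

(** By [B2_factor] the factors acquired multiply to x = X_(- e_i). *)
Lemma returns_B2 : returns hs 2 6 (-1).
Proof.
exists (-1) => v vi vj; have skew := seed_form_skew N s.
have U := @rank2_mon_unit s hs.
have step := ladder_factor1 hs si sj sij sol_B2P.
have := chain2 (chain2 (chain2 (erefl (chain 2 0 (-1) (mon (K (ob_at hs)) v) 0)))).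
rewrite !opprK (step 1%N isT isT).2 (step 3%N isT isT).1 (step 5%N isT isT).2.
rewrite !invrK => ->; congr (_, _, _).
rewrite [nth _ _ 2]/= [nth _ _ 4]/= [nth _ _ 6]/=.
rewrite (leval_eq E B2_factor) !(leval_lmul (rank2_monM hs si sj sij)).
set a := leval _ (one_plus 2 (-1) (first_var 2)).
set b := leval _ (one_plus 2 (-1) ly); set xV := leval _ lxV.
have Ua : a \is a GRing.unit by exact: U.
have Ub : b \is a GRing.unit by exact: U.
have Ux : xV \is a GRing.unit by exact: U.
rewrite invrM ?unitrMl // invrM // !mulrA mulrK // divrK //.
have -> : xV = mon _ (basis_vec i).
  by rewrite /xV leval1 /rank2_mon /= mulr0 fpow0 mul1r mulr0z sub0r mulrN1z opprK.
rewrite -monN // monM qformNr (qform_pairing si (integral_at x0N hs)) vi.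
by rewrite mulr0 oppr0 fpow0 mul1r mulrN1z.
Qed.

End B2.

Section G2.
Variables (s : seed I) (hs : equivalent x0 (AnySeed s)).
Hypotheses (si : i \notin frozen s) (sj : j \notin frozen s).
Hypotheses (sij : eps s i j = - 3%:R) (sji : eps s j i = 1).
Local Notation E := (rank2_mon hs).

(** The factors acquired cancel, since [g2_poly] occurs in both
    factorisations. *)
Lemma returns_G2 : returns hs 3 8 (-1).
Proof.
exists 0 => v vi vj.
have U := @rank2_mon_unit s hs.
have step := ladder_factor1 hs si sj sij sol_G2P.
have := chain2 (chain2 (chain2 (chain2
  (erefl (chain 3 0 (-1) (mon (K (ob_at hs)) v) 0))))).
rewrite !opprK (step 1%N isT isT).2 (step 3%N isT isT).1 (step 5%N isT isT).2.
rewrite (step 7%N isT isT).1 !invrK => ->; congr (_, _, _).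
rewrite [nth _ _ 2]/= [nth _ _ 4]/= [nth _ _ 6]/= [nth _ _ 8]/=.
rewrite (leval_eq E G2_factor3) (leval_eq E G2_factor5).
rewrite !(leval_lmul (rank2_monM hs si sj sij)).
set a := leval _ (one_plus 3 (-1) (first_var 3)).
set b := leval _ (one_plus 3 1 ly); set g := leval _ g2_poly.
have Ua : a \is a GRing.unit by exact: U.
have Ub : b \is a GRing.unit by exact: U.
have Ug : g \is a GRing.unit by exact: U.
by rewrite invrM // !mulrA mulrK // divrK // mulrK // mulr0z addr0.
Qed.

End G2.

Lemma sigma_mu_trivial p (s : seed I) (c : transf (AnySeed s) (AnySeed s)) hs :
  (0 < p < 4)%N -> i \notin frozen s -> j \notin frozen s ->
  eps s i j = - p%:R -> eps s j i = 1 ->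
  sigma_mu_power i j (coxeter_number p + 2) c ->
  forall l, transf_morph c hs hs (fgen _ l) = fgen _ l.
Proof.
move=> p03 si sj sij sji /sigma_mu_state st.
have {}st := st p hs hs si sj sij sji.
have p0 : (0 < p)%N by case/andP: p03.
apply: (state_trivial sij sji p0 st).
  case: p p03 sij {p0 st} => [|[|[|[|//]]]] // _ sij.
  - by rewrite (ysE hs si sj sij sol_A2P) // !leval1.
  - by rewrite (ysE hs si sj sij sol_B2P) // !leval1.
  - by rewrite (ysE hs si sj sij sol_G2P) // !leval1.
have ret0 r : r = 0 -> returns hs p (coxeter_number p + 2) r.
  by move=> ->; apply: returns0.
case: p p03 sij {p0 st} ret0 => [|[|[|[|//]]]] // _ sij ret0 b.
- by exists b; left; apply: ret0; ring.
(* Rounding (b + 1) / p down leaves b - p a between - 1 and p - 2. *)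
- exists ((b + 1) %/ 2)%Z; left; have := divz_eq (b + 1) 2.
  have := ltz_pmod (b + 1) (isT : 0 < 2 :> int).
  have := modz_ge0 (b + 1) (isT : 2 != 0 :> int).
  set r := (_ %% _)%Z; set q := (_ %/ _)%Z => r0 r2 bE.
  have [r1|r1] : r = 1 \/ r = 0 by lia.
    by apply: ret0; lia.
  have -> : b - 2%N%:Z * q = -1 by lia.
  exact: returns_B2.
exists ((b + 1) %/ 3)%Z; have := divz_eq (b + 1) 3.
have := ltz_pmod (b + 1) (isT : 0 < 3 :> int).
have := modz_ge0 (b + 1) (isT : 3 != 0 :> int).
set r := (_ %% _)%Z; set q := (_ %/ _)%Z => r0 r3 bE.
have [r1|[r1|r1]] : r = 1 \/ r = 0 \/ r = 2 by lia.
- by left; apply: ret0; lia.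
- left; have -> : b - 3%N%:Z * q = -1 by lia.
  exact: returns_G2.
- right; have -> : 3%N%:Z * q - b = -1 by lia.
  exact: returns_G2.
Qed.

End SigmaMu.

(** * Squares of mutations and commuting mutations *)

Definition mut_factor (R : unitRingType) (q : nat -> R) (e : rat) (Y : R) : R :=
  if e <= 0 then \prod_(1 <= a < `|numq e|.+1) (1 + q (2 * a - 1)%N * Y)
  else (\prod_(1 <= a < `|numq e|.+1) (1 + q (2 * a - 1)%N * Y^-1))^-1.

Lemma quantum_mutation_imageE (N : nat) (I : finType) (s : seed I) (k : I)
    (K : fraction_field (qtorus (seed_form N s))) i :
  quantum_mutation_image k K i = if i == k then (fgen K k)^-1
    else fgen K i * mut_factor (qk_pow k K) (eps s i k) (fgen K k).
Proof.
by rewrite /quantum_mutation_image /mut_factor; case: eqP => // _; case: ifP.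
Qed.

Section MutFactor.
Variables (R : unitRingType) (q : nat -> R) (Y : R).
Hypothesis YU : forall j, 1 + q j * Y \is a GRing.unit.
Hypothesis YVU : forall j, 1 + q j * Y^-1 \is a GRing.unit.

Lemma mut_factorN e : mut_factor q e Y * mut_factor q (- e) Y^-1 = 1.
Proof.
rewrite /mut_factor invrK oppr_le0 numqN abszN.
have [e0|e0|->] := ltgtP e 0.
- by rewrite mulrV // unitr_prod.
- by rewrite mulVr // unitr_prod.
- by rewrite !big_geq // mul1r.
Qed.

Lemma rmorph_mut_factor (S : unitRingType) (f : {rmorphism R -> S}) e :
  Y \is a GRing.unit ->
  f (mut_factor q e Y) = mut_factor (fun j => f (q j)) e (f Y).
Proof.
move=> U; rewrite /mut_factor; case: ifP => _.
  rewrite rmorph_prod; apply: eq_bigr => a _.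
  by rewrite rmorphD rmorph1 rmorphM.
rewrite rmorphV ?unitr_prod // rmorph_prod; congr _^-1; apply: eq_bigr => a _.
by rewrite rmorphD rmorph1 rmorphM rmorphV.
Qed.

Lemma mut_factor_comm e x : GRing.comm x Y -> (forall j, GRing.comm x (q j)) ->
  GRing.comm x (mut_factor q e Y).
Proof.
move=> xY xq; rewrite /mut_factor; case: ifP => _; last apply: commrV;
  apply: commr_prod => a _; apply: commrD; (try exact: commr1);
  apply: commrM => //; exact: commrV.
Qed.

End MutFactor.

Lemma fgen_factor_unit (I : finType) (B : I -> I -> int)
    (K : fraction_field (qtorus B)) (skew : forall i j, B i j = - B j i) m k :
  1 + fpow K m * fgen K k \is a GRing.unit /\
  1 + fpow K m * (fgen K k)^-1 \is a GRing.unit.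
Proof.
have U v : 1 + fpow K m * mon K v \is a GRing.unit.
  apply: frac_unit; have := @sum_mon_neq0 _ _ K _ [:: false; true]
    (fun b => if b then m else 0) (fun b => if b then v else 0) isT.
  by rewrite big_cons big_seq1 fpow0 mon0 mulr1.
by split; rewrite fgenE -?monN.
Qed.

Section Relations.
Variables (x0 : any_seed) (N : nat).
Hypothesis x0N : integral_seed N (seed_of x0).
Hypothesis N_gt0 : (0 < N)%N.
Variable K : forall x : Ob (special_groupoid x0),
  fraction_field (qtorus (seed_form N (seed_of (sval x)))).
Local Notation hom := (transf_hom x0N K).

Lemma transf_hom_mut (I : finType) (s s' : seed I) (k : I)
    (k_mut : k \notin frozen s) (k_mut' : k \notin frozen s')
    (ss' : s' = mutate k_mut) (s's : s = mutate k_mut')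
    (hs : equivalent x0 (AnySeed s)) :
  hom (Comp (Mut s's) (Mut ss')) hs hs = qpos_id (torus_at K hs).
Proof.
pose hs' := equivalent_trans hs (Mut ss').
rewrite (transf_hom_comp _ _ _ _ _ hs'); apply: qpos_hom_fgen_eq => i.
pose f := qpos_rmorphism (mut_hom x0N K ss' hs hs').
pose Ks := K (ob_at hs); pose Ks' := K (ob_at hs').
have fE j : f (fgen Ks' j) = quantum_mutation_image k Ks j.
  exact: mut_hom_gen.
have fq j : f (qk_pow k Ks' j) = qk_pow k Ks j.
  have dE : seed_d s' k = seed_d s k by rewrite ss'.
  by rewrite /qk_pow [f _](psm_pow (qmapP _)) /= dE.
transitivity (f (quantum_mutation_image k Ks' i)).
  by congr (f _); apply: (mut_hom_gen x0N K s's hs' hs).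
have skew := seed_form_skew N s; have skew' := seed_form_skew N s'.
have UX : fgen Ks' k \is a GRing.unit by exact: mon_unit skew' _.
rewrite quantum_mutation_imageE; case: eqP => [->|/eqP/negPf ik].
  by rewrite rmorphV // fE quantum_mutation_imageE eqxx invrK.
have U' j := fgen_factor_unit Ks' skew' (j * (N %/ seed_d s' k))%N k.
have U j := fgen_factor_unit Ks skew (j * (N %/ seed_d s k))%N k.
have fac := rmorph_mut_factor (q := qk_pow k Ks') (fun j => (U' j).2) f
  (eps s' i k) UX.
have facN := mut_factorN (q := qk_pow k Ks) (fun j => (U j).1) (fun j => (U j).2) (eps s i k).
have fqE : (fun j => f (qk_pow k Ks' j)) = qk_pow k Ks by apply/funext.
have e' : eps s' i k = - eps s i k.
  by rewrite ss' /= /mutate_eps eqxx orbT.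
rewrite rmorphM; apply: etrans (congr1 _ fac) _.
rewrite !fE !quantum_mutation_imageE eqxx ik -mulrA e'.
apply: etrans (congr1 _ _) (mulr1 _).
by rewrite -[RHS]facN; congr (_ * mut_factor _ _ _).
Qed.

Section Commuting.
Variables (I : finType) (i j : I).
Hypothesis ij : i != j.

(** The effect of one [sigma_ij o mu_i] on the entries of the exchange matrix
    at [i] and [j] and on the images of [X_i], [X_j] and [X_l], when
    [eps_ij = 0]. *)
Definition commuting_step (R : unitRingType)
    (d : (rat * rat) * ((nat -> R) * (nat -> R)) * (R * R) * R) :=
  let: ((a, b), (qi, qj), (Yi, Yj), Yl) := d in
  ((b, - a), (qj, qi), (Yj, Yi^-1), Yl * mut_factor qi a Yi).

Definition commuting_data (s t : seed I) (c : transf (AnySeed s) (AnySeed t))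
    hs ht (l : I) :=
  let F := transf_morph x0N K c hs ht in
  ((eps t l i, eps t l j),
   (fun m => F (qk_pow i (K (ob_at ht)) m), fun m => F (qk_pow j (K (ob_at ht)) m)),
   (F (fgen _ i), F (fgen _ j)), F (fgen _ l)).

Lemma commuting_pairS (s t u v : seed I) (c : transf (AnySeed s) (AnySeed t))
    (it : i \notin frozen t) (tu : u = mutate it)
    (uv : seed_iso u v (tperm i j)) hs ht hv : eps t j i = 0 ->
  let F := transf_morph x0N K c hs ht in
  let F' := transf_morph x0N K (Comp (Iso uv) (Comp (Mut tu) c)) hs hv in
  F' (fgen _ i) = F (fgen _ j) /\ F' (fgen _ j) = (F (fgen _ i))^-1.
Proof.
move=> tji F F'; have gen := sigma_mu_gen x0N K tu uv c hs ht (hv := hv).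
have UX : fgen (K (ob_at ht)) i \is a GRing.unit.
  exact: mon_unit (seed_form_skew N t) _.
rewrite /F' !gen tpermL tpermR !quantum_mutation_imageE eqxx eq_sym (negPf ij).
rewrite rmorphV //; split=> //.
by rewrite /= tji /mut_factor lexx big_geq // mulr1.
Qed.

Lemma commuting_dataS (s t u v : seed I) (c : transf (AnySeed s) (AnySeed t))
    (it : i \notin frozen t) (tu : u = mutate it)
    (uv : seed_iso u v (tperm i j)) hs ht hv l :
  eps t i j = 0 -> eps t j i = 0 -> l != i -> l != j ->
  commuting_data (Comp (Iso uv) (Comp (Mut tu) c)) hs hv l
    = commuting_step (commuting_data c hs ht l).
Proof.
move=> tij tji li lj; have lE : tperm i j l = l by rewrite tpermD // eq_sym.
set F := transf_morph x0N K c hs ht.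
have dv l' : seed_d v (tperm i j l') = seed_d t l' by rewrite (iso_d uv) tu.
have skew := seed_form_skew N t.
have U m := fgen_factor_unit (K (ob_at ht)) skew (m * (N %/ seed_d t i))%N i.
have UX : fgen (K (ob_at ht)) i \is a GRing.unit by exact: mon_unit skew _.
have facE e := rmorph_mut_factor (q := qk_pow i (K (ob_at ht)))
  (fun m => (U m).2) F e UX.
have gen l' := sigma_mu_gen x0N K tu uv c hs ht (hv := hv) l'.
rewrite /commuting_data /commuting_step (gen l) lE.
rewrite quantum_mutation_imageE (negPf li).
congr (_, _, _, _).
- congr (_, _); rewrite -[X in eps v X _]lE.
    rewrite -[X in eps v _ X](tpermR i j) (sigma_mu_eps tu uv) /mutate_eps.
    by rewrite tij mulr0 lexx eq_sym (negPf li) (negPf ij).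
  rewrite -[X in eps v _ X](tpermL i j) (sigma_mu_eps tu uv) /mutate_eps.
  by rewrite eqxx orbT.
- have tp a b m : seed_d v a = seed_d t b ->
      transf_morph x0N K (Comp (Iso uv) (Comp (Mut tu) c)) hs hv
        (qk_pow a (K (ob_at hv)) m) = F (qk_pow b (K (ob_at ht)) m).
    by move=> ab; rewrite !transf_morph_pow /= ab.
  congr (_, _); apply/funext => m; apply: tp.
    by rewrite -[X in seed_d v X](tpermR i j) dv.
  by rewrite -[X in seed_d v X](tpermL i j) dv.
- by have [<- <-] := commuting_pairS c tu uv hs ht hv tji.
by rewrite rmorphM; congr (_ * _); apply: facE.
Qed.

Lemma commuting_state n (s t : seed I) (c : transf (AnySeed s) (AnySeed t)) :
  @sigma_mu_power I i j n s t c -> forall hs ht,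
  eps s i j = 0 -> eps s j i = 0 ->
  let F := transf_morph x0N K c hs ht in
  [/\ eps t i j = 0, eps t j i = 0,
      (F (fgen _ i), F (fgen _ j))
        = iter n (fun d => (d.2, d.1^-1)) (fgen _ i, fgen _ j)
    & forall l, l != i -> l != j -> commuting_data c hs ht l
        = iter n (@commuting_step _)
            (commuting_data (transf_id (AnySeed s)) hs hs l)].
Proof.
elim=> {n s t c} [s|n s t u v c it tu uv _ IH] hs ht sij sji F.
  move: @F; rewrite (Prop_irrelevance ht hs) => F; split=> //.
  by rewrite /F /transf_morph -!qpos_rmorphismE !transf_hom_id.
have [tij tji Fij Fl] := IH hs (equivalent_trans hs c) sij sji.
split.
- rewrite -[X in eps v X _](tpermR i j) -[X in eps v _ X](tpermL i j).
  by rewrite (sigma_mu_eps tu uv) /mutate_eps eqxx orbT tji oppr0.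
- rewrite -[X in eps v X _](tpermL i j) -[X in eps v _ X](tpermR i j).
  by rewrite (sigma_mu_eps tu uv) /mutate_eps eqxx tij oppr0.
- have [Fi Fj] := commuting_pairS c tu uv hs (equivalent_trans hs c) ht tji.
  by rewrite iterS -Fij; congr (_, _).
by move=> l li lj; rewrite iterS -Fl // -(commuting_dataS c tu uv).
Qed.

(** Up to relabelling the four steps mutate at i, j, i, j.  The two mutations
    at i, and the two at j, contribute inverse factors, and the factors at i
    and j commute. *)
Lemma commuting_trivial (s : seed I) (c : transf (AnySeed s) (AnySeed s)) hs :
  sigma_mu_power i j 4 c -> eps s i j = 0 -> eps s j i = 0 ->
  forall l, transf_morph x0N K c hs hs (fgen _ l) = fgen _ l.
Proof.
move=> c4 sij sji; have [_ _ Fij Fl] := commuting_state c4 hs hs sij sji.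
move: Fij; rewrite /= !invrK => -[Fi Fj] l.
have [->|li] := eqVneq l i; first exact: Fi.
have [->|lj] := eqVneq l j; first exact: Fj.
pose Ks := K (ob_at hs); have skew := seed_form_skew N s.
have idE x : iso_hom K (seed_iso_id s) hs hs x = x.
  by rewrite -[RHS]/(qpos_id (torus_at K hs) x) -(transf_hom_id x0N K hs).
have qE k : (fun m => iso_hom K (seed_iso_id s) hs hs (qk_pow k Ks m))
    = qk_pow k Ks by apply/funext => m; apply: idE.
have := congr1 snd (Fl l li lj); rewrite /= !qE !idE => ->.
have inv k e : mut_factor (qk_pow k Ks) e (fgen Ks k)
    * mut_factor (qk_pow k Ks) (- e) (fgen Ks k)^-1 = 1.
  by apply: mut_factorN => m; have [] := fgen_factor_unit Ks skew (m * (N %/ seed_d s k))%N k.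
have XX : GRing.comm (fgen Ks j) (fgen Ks i).
  have := mon_comm Ks skew (v := basis_vec j) (w := basis_vec i).
  by apply; rewrite qform_basis2 /seed_form /eps_hat sji mul0r mulr0.
have comm : GRing.comm (mut_factor (qk_pow j Ks) (eps s l j) (fgen Ks j))
    (mut_factor (qk_pow i Ks) (- eps s l i) (fgen Ks i)^-1).
  apply: mut_factor_comm => [|m]; last exact/commr_sym/fpowC.
  apply: commrV; apply/commr_sym; apply: mut_factor_comm => [|m].
    exact: commr_sym.
  exact/commr_sym/fpowC.
rewrite -!mulrA [X in _ * (_ * X)]mulrA comm -[X in _ * (_ * X)]mulrA inv mulr1.
by rewrite inv mulr1.
Qed.

End Commuting.

(** * The functor on classes *)

Lemma special_trivial_hom (I : finType) (s : seed I)
    (c : transf (AnySeed s) (AnySeed s)) hs :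
  special_trivial c -> hom c hs hs = qpos_id (torus_at K hs).
Proof.
case=> i [j [p [/andP [si sj] ij p4 [eij eijp] cP]]].
apply: qpos_hom_fgen_eq => l; rewrite [LHS](_ : _ = transf_morph x0N K c hs hs (fgen _ l)) //.
have [p0|p0] := posnP p.
  move: eijp eij cP; rewrite p0 oppr0 => sij _ c4.
  have sji : eps s j i = 0.
    have := eps_skew s i j; rewrite sij mul0r => /esym/eqP.
    by rewrite oppr_eq0 mulf_eq0 invr_eq0 (negPf (seed_d_neq0 s i)) orbF => /eqP.
  exact: (commuting_trivial ij c4 sij sji).
apply: (sigma_mu_trivial x0N N_gt0 K ij _ si sj eijp _ cP); first by rewrite p0.
have pn0 : p%:R != 0 :> rat by rewrite pnatr_eq0 -lt0n.
by move: eij; rewrite eijp => /oppr_inj; rewrite -{1}[p%:R]mulr1 => /(mulfI pn0).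
Qed.

Lemma transf_hom_eq x y (a b : transf x y) : transf_eq a b ->
  forall hx hy, hom a hx hy = hom b hx hy.
Proof.
elim=> {x y a b}.
- by [].
- by move=> x y a b _ IH hx hy; rewrite IH.
- by move=> x y a b c _ IH1 _ IH2 hx hy; rewrite IH1.
- move=> x y z a a' b b' _ IHa _ IHb hx hz; pose hy := equivalent_trans hx b.
  by rewrite !(transf_hom_comp _ _ _ _ _ hy) IHa IHb.
- move=> x y z w a b c hx hw; pose hy := equivalent_trans hx c.
  pose hz := equivalent_trans hy b.
  by rewrite !(transf_hom_comp _ _ _ _ _ hz) !(transf_hom_comp _ _ _ _ _ hy) -qpos_compA.
- by move=> x y a hx hy; rewrite (transf_hom_comp _ _ _ _ _ hy) transf_hom_id qpos_comp1r.
- by move=> x y a hx hy; rewrite (transf_hom_comp _ _ _ _ _ hx) transf_hom_id qpos_comp1l.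
- move=> I J L s t u f g st tu su hs hu; pose ht := equivalent_trans hs (Iso st).
  apply: qpos_hom_fgen_eq => i; rewrite (transf_hom_comp _ _ _ _ _ ht).
  have [g' gK g'K] := iso_bij tu; have [f' fK f'K] := iso_bij st.
  rewrite -(g'K i) -(f'K (g' i)) /=.
  by rewrite (iso_hom_gen K tu) (iso_hom_gen K st) (iso_hom_gen K su hs hu).
- move=> I s s' k k_mut k_mut' ss' s's hs hs2.
  by rewrite (Prop_irrelevance hs2 hs) transf_hom_mut transf_hom_id.
- move=> I s c sc hs hs2.
  by rewrite (Prop_irrelevance hs2 hs) special_trivial_hom // transf_hom_id.
Qed.

End Relations.

Theorem proposition3p8 (I0 : finType) (s0 : seed I0) (N : nat)
  (N_gt0 : (0 < N)%N)
  (N_form : forall i j, N%:R * eps_hat s0 i j \is a Num.int)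
  (N_d : forall i, (seed_d s0 i %| N)%N)
  (K : forall x : Ob (special_groupoid (AnySeed s0)),
    fraction_field (qtorus (seed_form N (seed_of (sval x))))) :
  exists Fmap : forall x y : Ob (special_groupoid (AnySeed s0)),
      Mor (special_groupoid (AnySeed s0)) x y ->
      Mor QPos_star (seed_qtorus (K x)) (seed_qtorus (K y)),
  [/\ is_functor Fmap,
      forall (I : finType) (s s' : seed I) (k : I) (k_mut : k \notin frozen s)
        (ss' : s' = mutate k_mut)
        (hs : equivalent (AnySeed s0) (AnySeed s))
        (hs' : equivalent (AnySeed s0) (AnySeed s')),
        is_quantum_mutation k
          (qmap (Fmap (seed_ob hs) (seed_ob hs') (class_of_transf (Mut ss'))))
    & forall (I J : finType) (s : seed I) (t : seed J) (sigma : I -> J)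
        (st : seed_iso s t sigma)
        (hs : equivalent (AnySeed s0) (AnySeed s))
        (ht : equivalent (AnySeed s0) (AnySeed t)),
        is_relabelling sigma
          (qmap (Fmap (seed_ob hs) (seed_ob ht) (class_of_transf (Iso st))))].
Proof.
have x0N : integral_seed N (seed_of (AnySeed s0)) by [].
pose Fmap (x y : Ob (special_groupoid (AnySeed s0))) :
    Mor (special_groupoid (AnySeed s0)) x y ->
    Mor QPos_star (seed_qtorus (K x)) (seed_qtorus (K y)) :=
  match x, y return Mor (special_groupoid (AnySeed s0)) x y ->
    Mor QPos_star (seed_qtorus (K x)) (seed_qtorus (K y)) with
  | exist x' hx, exist y' hy => fun A => transf_hom x0N K (class_repr A) hx hy
  end.
have FmapE x y (c : transf x y) hx hy :
    Fmap (ob_at hx) (ob_at hy) (class_of_transf c) = transf_hom x0N K c hx hy.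
  apply: (transf_hom_eq x0N N_gt0 K); apply/class_eqP; exact: class_reprK.
exists Fmap; split.
- split=> [[x hx]|[x hx] [y hy] [z hz] f g].
    by rewrite [LHS]FmapE transf_hom_id.
  rewrite [LHS](FmapE _ _ (Comp (class_repr f) (class_repr g))).
  exact: transf_hom_comp.
- by move=> I s s' k k_mut ss' hs hs'; rewrite FmapE; apply: mut_hom_gen.
- by move=> I J s t f st hs ht; rewrite FmapE; apply: iso_hom_gen.
Qed.
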